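(* Let $q$ be a prime power, $F_q$ the field with $q$ elements, $V=F_q^n$, and $1<k<n-1$. Let $S$ be a $(k-1)$-dimensional linear code in $V$ whose generator matrix $M$ has exactly one zero column, let $M'$ be the matrix obtained from $M$ by deleting the zero column, let $S'\subseteq F_q^{n-1}$ be the code generated by $M'$, and suppose that $M'$ contains proportional columns. Then $[S\rangle^{\Pi}_{k}$ is a star of $\Pi[n,k]_q$ if and only if $l(k_j)\le q$ for all columns $k_j$ of $M$ and one of the following holds: (1) $q=2$ and either $l(S')=k=3$ and $k<n-2$, or $l(S')\ge k+1$ and $k<n-2$; (2) $q=3$ and either $l(S')=k-1=1$, or $l(S')=k-1$ and $|L|\ge 2$, or $l(S')\ge k$; (3) $q\ge 4$. Here $L$ is the set of equivalence classes of columns of $M$ containing more than one column.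
   Context: A linear code $[n,k]_q$ is a $k$-dimensional subspace of $V=F_q^n$; a generator matrix is a matrix whose rows form a basis of it. A code is projective if the columns of a generator matrix are non-zero and pairwise non-proportional. $\Pi(n,k)_q$ denotes the set of all $k$-dimensional projective codes in $V$, and $\Pi[n,k]_q$ is the simple graph with vertex set $\Pi(n,k)_q$ in which two distinct codes are adjacent iff their intersection is $(k-1)$-dimensional. A clique is a set of pairwise adjacent vertices; it is maximal if not properly contained in another clique. $[S\rangle^{\Pi}_{k}$ denotes the set of all elements of $\Pi(n,k)_q$ containing $S$; it is called a star of $\Pi[n,k]_q$ if it is a maximal clique of $\Pi[n,k]_q$. Two columns $c,c'$ of a matrix are called equivalent if $c'=\lambda c$ for some nonzero $\lambda\in F_q$; $l(k_j)$ is the number of columns of $M$ in the equivalence class of the column $k_j$, and $l(S')$ is the number of equivalence classes of columns of $M'$.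
   Formalization: Cliques are required to be nonempty; this matters only when there are no k-dimensional projective codes at all, where the empty set would otherwise be a maximal clique and the equivalence would fail (e.g. q=2, k=2, n=4). *)

(* Defs.v *)
From HB Require Import structures.
From mathcomp Require Import all_boot all_order all_algebra.
From mathcomp Require Import classical_sets.

Set Implicit Arguments.
Unset Strict Implicit.
Unset Printing Implicit Defensive.

Import GRing.Theory.
Local Open Scope ring_scope.

Section Graphs.
Variables (T : Type) (V : set T) (adj : rel T).

(* Cliques are nonempty by convention. This only matters when the vertex set
   is empty: otherwise the empty set lies in some singleton clique and is never
   maximal, whereas in the graph without vertices it would be a maximal
   clique. *)
Definition clique (A : set T) : Prop :=
  [/\ (A !=set0)%classic,
      (A `<=` V)%classic
    & forall x y, A x -> A y -> x <> y -> adj x y].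

Definition maximal_clique (A : set T) : Prop :=
  clique A /\ forall B, clique B -> ~ (A `<` B)%classic.

End Graphs.

Section Columns.
Variables (F : finFieldType) (m n : nat).
Implicit Type M : 'M[F]_(m, n).

Definition col_equiv M : rel 'I_n :=
  [rel i j | [exists c : F, (c != 0) && (col j M == c *: col i M)]].

(* Equivalence classes are sets of column positions, so that repeated columns
   are counted with multiplicity. Zero columns form a class of their own. *)
Definition col_classes M : {set {set 'I_n}} :=
  equivalence_partition (col_equiv M) [set: 'I_n].

(* l(k_j), for the column k_j of M *)
Definition class_size M (j : 'I_n) : nat := #|[set i | col_equiv M j i]|.

(* L *)
Definition repeated_classes M : {set {set 'I_n}} :=
  [set A in col_classes M | (1 < #|A|)%N].

Definition has_proportional_cols M : Prop :=
  exists i j : 'I_n, i != j /\ col_equiv M i j.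

End Columns.

Section Codes.
Variables (F : finFieldType) (n : nat).
Implicit Types C D S : {vspace 'rV[F]_n}.

Definition generator_matrix m (M : 'M[F]_(m, n)) C : Prop :=
  basis_of C [seq row i M | i : 'I_m].

(* Replacing the generator matrix M by A *m M with A invertible preserves the
   condition on the columns, so the choice of M is irrelevant. *)
Definition projective C : Prop :=
  exists M : 'M[F]_(\dim C, n),
    [/\ generator_matrix M C,
        forall j, col j M != 0
      & ~ has_proportional_cols M].

Definition projective_codes (k : nat) : set {vspace 'rV[F]_n} :=
  [set C | \dim C = k /\ projective C]%classic.

Definition code_adj (k : nat) : rel {vspace 'rV[F]_n} :=
  [rel C D | (C != D) && (\dim (C :&: D) == (k - 1)%N)].

(* [S>_k^Pi *)
Definition codes_above (k : nat) S : set {vspace 'rV[F]_n} :=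
  [set C | projective_codes k C /\ (S <= C)%VS]%classic.

Definition is_star (k : nat) S : Prop :=
  maximal_clique (projective_codes k) (code_adj k) (codes_above k S).

End Codes.

(* Main.v *)
(* Call a subspace unpinned when no two coordinates are proportional on it; these
   are the projective codes. Scaling the columns of M within each class, a code
   S + <v> is projective iff v is nonzero at j0 and injective on every class of
   columns, so projective extensions exist iff all classes have at most q
   elements. A projective code D adjacent to all codes above S, but not
   containing S, lies with all of them in D + S, which has dimension at most
   k + 1. Changing v at one column, or exchanging two of its values within a
   class, shows that the codes above S span a space of dimension
   1 + sum_c min(|c|, q - 1), with c ranging over the classes other than {j0}. If
   this exceeds k + 1 we have a star. Otherwise q <= 3, and the codes above S lie
   in an explicit W of dimension k + 1; one looks for a projective hyperplane of W
   not containing S, that is, for a linear form on W that is nonzero on S and is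
   not a combination of two coordinates. *)
Require Import Defs.
From HB Require Import structures.
From mathcomp Require Import all_boot all_order all_algebra perm finfield.
From mathcomp Require Import ring zify.

Set Implicit Arguments.
Unset Strict Implicit.
Unset Printing Implicit Defensive.

Import GRing.Theory.
Local Open Scope ring_scope.

(** * Subspaces of ['rV[F]_n]: hyperplanes, dimensions and coordinate relations *)

Section Coordinates.
Variables (F : finFieldType) (n : nat).
Implicit Types (C D E S W : {vspace 'rV[F]_n}) (v w x : 'rV[F]_n).
Implicit Types (i j : 'I_n) (c t : F).

Definition linear_functional (f : 'rV[F]_n -> F) :=
  forall c v w, f (c *: v + w) = c * f v + f w.

Lemma functional0 f : linear_functional f -> f 0 = 0.
Proof. by move=> hf; have := hf (-1) 0 0; rewrite scaler0 addr0 mulN1r addNr. Qed.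

Lemma vspace_of_pred (P : pred 'rV[F]_n) :
    P 0 -> (forall c v w, P v -> P w -> P (c *: v + w)) ->
  exists E, forall v, (v \in E) = P v.
Proof.
move=> P0 PD; exists <<enum P>>%VS => v; apply/idP/idP; last first.
  by move=> Pv; apply: memv_span; rewrite mem_enum.
rewrite -[enum P]in_tupleE => /coord_span ->.
apply: (big_ind P) => // [x y Px Py|i _]; first by rewrite -[x]scale1r; apply: PD.
rewrite -[_ *: _]addr0; apply: PD => //.
by have := mem_nth 0 (ltn_ord i); rewrite mem_enum.
Qed.

Lemma dim_addv_line W x : x \notin W -> \dim (W + <[x]>) = (\dim W).+1.
Proof.
move=> xW; have x0 : x != 0 by apply: contraNneq xW => ->; rewrite mem0v.
rewrite dimv_disjoint_sum ?dim_vline ?x0 ?addn1 //.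
apply/eqP; rewrite -subv0; apply/subvP => v; rewrite memv_cap memv0.
case/andP=> vW /vlineP[c vE]; move: vW; rewrite vE.
case: (eqVneq c 0) => [->|c0]; first by rewrite scale0r eqxx.
by move=> cxW; case/negP: xW; rewrite -[x](scalerK c0) memvZ.
Qed.

Lemma hyperplane W f x : linear_functional f -> x \in W -> f x != 0 ->
  exists D, [/\ (D <= W)%VS, (\dim D).+1 = \dim W
    & forall v, (v \in D) = (v \in W) && (f v == 0)].
Proof.
move=> hf xW fx.
have [||D hD] := @vspace_of_pred (fun v => (v \in W) && (f v == 0)).
- by rewrite mem0v functional0 ?eqxx.
- move=> c v w /andP[vW /eqP fv] /andP[wW /eqP fw].
  by rewrite hf fv fw mulr0 addr0 eqxx andbT memvD ?memvZ.
have DW : (D <= W)%VS by apply/subvP => v; rewrite hD => /andP[].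
exists D; split=> //.
have xD : x \notin D by rewrite hD xW.
have defW : W = (D + <[x]>)%VS.
  apply/eqP; rewrite eqEsubv subv_add DW -memvE xW !andbT.
  apply/subvP => v vW.
  have -> : v = (v - (f v / f x) *: x) + (f v / f x) *: x by rewrite subrK.
  apply: memv_add; last by rewrite memvZ ?memv_line.
  rewrite hD memvB ?memvZ //= -scaleNr addrC hf mulNr divfK //.
  by rewrite addNr eqxx.
by rewrite defW dim_addv_line.
Qed.

Lemma generator_matrixE m (M : 'M[F]_(m, n)) C : generator_matrix M C ->
  (forall k, row k M \in C) /\
  (forall a : 'I_n -> F, (forall k, \sum_j a j * M k j = 0) ->
     forall v, v \in C -> \sum_j a j * v 0 j = 0).
Proof.
move=> /andP[/eqP spM fM]; split=> [i|a hM v].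
  by rewrite -spM; apply: memv_span; apply: image_f.
rewrite -spM -[image_mem _ _]in_tupleE => /coord_span ->.
under eq_bigr => j _ do rewrite summxE mulr_sumr.
rewrite exchange_big big1 // => i _ /=.
rewrite -[RHS](mulr0 (coord (in_tuple [seq row i M | i : 'I_m]) i v)).
have /mapP[i' _ ->] := mem_nth 0 (ltn_ord i).
rewrite -[X in _ = _ * X](hM i') mulr_sumr; apply: eq_bigr => j _.
by rewrite !mxE mulrCA.
Qed.

(** The values of a basis of [E] at the positions in [J] form a matrix with more rows than columns,
    so its left kernel is nonzero. *)
Lemma exists_relation E (J : {set 'I_n}) : (\dim E < #|J|)%N ->
  exists2 a : 'I_n -> F, exists2 j, j \in J & a j != 0 &
    forall v, v \in E -> \sum_(j in J) a j * v 0 j = 0.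
Proof.
move=> dJ.
pose N := \matrix_(j < #|J|, i < \dim E) (vbasis E)`_i 0 (enum_val j).
have : kermx N != 0.
  rewrite kermx_eq0 /row_free neq_ltn (leq_ltn_trans (rank_leq_col _)) //.
case/rowV0Pn => a /sub_kermxP aN a0.
(* Extends the kernel vector by zero outside [J]; the sum has at most one term because [enum_val] is
   injective. *)
pose a' (i : 'I_n) := \sum_(j | enum_val j == i) a 0 j.
have a'E (j : 'I_#|J|) : a' (enum_val j) = a 0 j.
  rewrite /a' (bigD1 j) //= big1 ?addr0 // => j' /andP[/eqP/enum_val_inj ->].
  by rewrite eqxx.
exists a'.
  case/rV0Pn: a0 => j aj; exists (enum_val j); first exact: enum_valP.
  by rewrite a'E.
move=> v /coord_vbasis ->.
under eq_bigr => j _ do rewrite summxE mulr_sumr.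
rewrite exchange_big big1 // => i _ /=.
transitivity (coord (vbasis E) i v * (a *m N) 0 i); last by rewrite aN mxE mulr0.
rewrite mxE mulr_sumr big_enum_val; apply: eq_bigr => j _.
by rewrite !mxE a'E mulrCA.
Qed.

Lemma dim_le_coords E (J : {set 'I_n}) :
  (forall v, v \in E -> (forall j, j \in J -> v 0 j = 0) -> v = 0) ->
  (\dim E <= #|J|)%N.
Proof.
move=> EJ.
pose A := \matrix_(i < n, j < #|J|) ((i == enum_val j)%:R : F).
pose f := linfun (mulmxr A : 'rV[F]_n -> 'rV[F]_#|J|).
have fE v (j : 'I_#|J|) : f v 0 j = v 0 (enum_val j).
  rewrite lfunE /= mxE (bigD1 (enum_val j)) //= big1 ?addr0 ?mxE ?eqxx ?mulr1 //.
  by move=> i /negPf ne; rewrite mxE ne mulr0.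
have inj : (E :&: lker f = 0)%VS.
  apply/eqP; rewrite -subv0; apply/subvP => v; rewrite memv_cap memv0.
  case/andP => vE; rewrite memv_ker => /eqP fv; apply/eqP/EJ => // j jJ.
  by have := fE v (enum_rank_in jJ j); rewrite fv mxE enum_rankK_in.
rewrite -(limg_dim_eq inj) (leq_trans (dimvS (subvf _))) // dimvf /dim /=.
by rewrite mul1n.
Qed.

(** * Projective codes as unpinned subspaces *)

Definition pinned C i j c := forall v, v \in C -> v 0 j = c * v 0 i.

(** The value [c = 0] is allowed: with at least two coordinates this also rules out a coordinate
    that vanishes on [C], so zero columns and proportional columns become one condition. *)
Definition unpinned C := forall i j c, i != j -> ~ pinned C i j c.

Lemma pinnedS C D i j c : (C <= D)%VS -> pinned D i j c -> pinned C i j c.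
Proof. by move=> /subvP CD pD v /CD /pD. Qed.

Lemma generator_matrix_exists C : exists M : 'M[F]_(\dim C, n), generator_matrix M C.
Proof.
exists (\matrix_i (vbasis C)`_i); rewrite /generator_matrix.
suff -> : [seq row i (\matrix_i (vbasis C)`_i) | i : 'I_(\dim C)] = vbasis C.
  exact: vbasisP.
apply: (@eq_from_nth _ 0); first by rewrite size_map size_enum_ord size_tuple.
move=> i; rewrite size_map size_enum_ord => ilt.
by rewrite (nth_map (Ordinal ilt)) ?size_enum_ord // rowK nth_enum_ord.
Qed.

Lemma pinnedP m (M : 'M[F]_(m, n)) C i j c : generator_matrix M C ->
  pinned C i j c <-> col j M = c *: col i M.
Proof.
move=> hM; have [rC hC] := generator_matrixE hM; split=> [pC|cM v vC].
  by apply/colP => k; have := pC _ (rC k); rewrite !mxE.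
pose a l := (l == j)%:R - c * (l == i)%:R : F.
have aE (w : 'I_n -> F) : \sum_l a l * w l = w j - c * w i.
  under eq_bigr => l _ do rewrite mulrBl -mulrA.
  rewrite big_split /= sumrN -mulr_sumr.
  suff dl k : \sum_l (l == k)%:R * w l = w k by rewrite !dl.
  by rewrite (bigD1 k) //= eqxx mul1r big1 ?addr0 // => l /negPf ->; rewrite mul0r.
apply/eqP; rewrite -subr_eq0 -aE; apply/eqP/hC => // k.
by rewrite aE; have /colP/(_ k) := cM; rewrite !mxE => ->; rewrite subrr.
Qed.

Lemma exists_ord_neq j : (1 < n)%N -> exists i, i != j.
Proof.
move=> n1; suff /card_gt0P[i] : (0 < #|[set~ j]|)%N by rewrite !inE; exists i.
by rewrite cardsC1 card_ord -subn1 subn_gt0.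
Qed.

Lemma unpinned_neq0 C j : (1 < n)%N -> unpinned C -> exists2 v, v \in C & v 0 j != 0.
Proof.
move=> n1 uC; have [i ij] := exists_ord_neq j n1.
have : ~~ [forall v, (v \in C) ==> (v 0 j == 0)].
  apply/negP => /forallP h; apply: (uC i j 0 ij) => v vC.
  by have := h v; rewrite vC mul0r => /eqP.
by case/forallPn => v; rewrite negb_imply => /andP[]; exists v.
Qed.

Lemma projectiveP C : (1 < n)%N -> projective C <-> unpinned C.
Proof.
move=> n1; split.
  case=> M [gM M0 Mp] i j c ij /(pinnedP _ _ _ gM) cM.
  have [c0|c0] := eqVneq c 0; first by case/eqP: (M0 j); rewrite cM c0 scale0r.
  by apply: Mp; exists i, j; split=> //; apply/existsP; exists c; rewrite c0 cM eqxx.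
move=> uC; have [M gM] := generator_matrix_exists C; exists M; split=> // [j|].
  apply/eqP => Mj.
  have [i ij] := exists_ord_neq j n1.
  by apply: (uC i j 0 ij); apply/(pinnedP _ _ _ gM); rewrite Mj scale0r.
case=> i [j [ij /existsP[c /andP[_ /eqP cM]]]].
by apply: (uC i j c ij); apply/(pinnedP _ _ _ gM).
Qed.

(** * Adjacency of codes and criteria for a star *)

Lemma codes_aboveP k S C : (1 < n)%N ->
  codes_above k S C <-> [/\ \dim C = k, unpinned C & (S <= C)%VS].
Proof.
move=> n1; split; first by case=> -[dC /(projectiveP _ n1)].
by case=> dC /(projectiveP _ n1).
Qed.

(** If [D] is pinned, the form [w j - c * w i] vanishes on the kernel of [f] in [W], hence is a
    multiple [t * f] on [W]. For [t = 0] this pins [W]; for [t != 0] it is excluded by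
    assumption. *)
Lemma unpinned_hyperplane W D f x :
    linear_functional f -> x \in W -> f x != 0 ->
    (forall v, (v \in D) = (v \in W) && (f v == 0)) -> unpinned W ->
    (forall i j c t, i != j -> t != 0 ->
       ~ forall w, w \in W -> w 0 j - c * w 0 i = t * f w) ->
  unpinned D.
Proof.
move=> hf xW fx hD uW hW i j c ij pD.
pose t := (x 0 j - c * x 0 i) / f x.
have key w : w \in W -> w 0 j - c * w 0 i = t * f w.
  (* The projection of [w] to [D] along [x]. *)
  move=> wW; have : - (f w / f x) *: x + w \in D.
    by rewrite hD memvD ?memvZ //= hf mulNr divfK // addNr.
  move=> /pD; rewrite !mxE => e; apply/eqP; rewrite -subr_eq0.
  rewrite /t -[X in _ == X](subrr (- (f w / f x) * x 0 j + w 0 j)) {2}e.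
  by apply/eqP; field.
have [t0|t0] := eqVneq t 0; last exact: (hW i j c t).
by apply: (uW i j c ij) => w /key /eqP; rewrite t0 mul0r subr_eq0 => /eqP.
Qed.

(** An intersection of dimension [k] would force [C = D], so a lower bound is enough. *)
Lemma code_adjI k C D : (0 < k)%N -> \dim C = k -> \dim D = k -> C != D ->
  (k - 1 <= \dim (C :&: D))%N -> code_adj k C D.
Proof.
move=> k0 dC dD neq le; rewrite /code_adj /= neq eqn_leq le andbT.
rewrite -ltnS subn1 prednK // ltn_neqAle -{2}dC dimvS ?capvSl // andbT.
apply: contra neq => /eqP dcap.
have /eqP capC : (C :&: D == C)%VS by rewrite eqEdim capvSl dC dcap leqnn.
by rewrite eqEdim dC dD leqnn andbT -capC capvSr.
Qed.

(** The kernel [D] of [f] on [W] is a projective code that does not contain [S]. Two hyperplanes of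
    [W] meet in dimension at least [k - 1], so [D] is adjacent to every code above [S] and can be
    added to the clique. *)
Lemma not_star k S W f x : (1 < n)%N -> (0 < k)%N -> \dim S = (k - 1)%N ->
    linear_functional f -> x \in S -> f x != 0 ->
    \dim W = k.+1 -> (forall C, codes_above k S C -> (C <= W)%VS) ->
    (forall i j c t, i != j -> t != 0 ->
       ~ forall w, w \in W -> w 0 j - c * w 0 i = t * f w) ->
  ~ is_star k S.
Proof.
move=> n1 k0 dS hf xS fx dW CW hW [[[C0 C0S] _ cl] mx].
have [_ uC0 SC0] := (codes_aboveP k S C0 n1).1 C0S.
have SW : (S <= W)%VS := subv_trans SC0 (CW _ C0S).
have xW : x \in W by move/subvP: SW; apply.
have uW : unpinned W.
  by move=> i j c ij /(pinnedS (CW _ C0S)); apply: uC0.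
have [D [DW dD hD]] := hyperplane hf xW fx.
have uD := unpinned_hyperplane hf xW fx hD uW hW.
have {}dD : \dim D = k by apply: succn_inj; rewrite dD dW.
have nSD : ~~ (S <= D)%VS.
  by apply: contra fx => /subvP/(_ x xS); rewrite hD => /andP[].
have DC C : codes_above k S C -> code_adj k D C.
  move=> CS; have [dC _ SC] := (codes_aboveP k S C n1).1 CS.
  have neq : D != C by apply: contraNneq nSD => ->.
  apply: code_adjI => //; have := dimv_sum_cap D C.
  have : (\dim (D + C) <= k.+1)%N by rewrite -dW dimvS // subv_add DW CW.
  by move: (\dim _) (\dim _); rewrite dD dC; clear; lia.
have symadj A B : code_adj k A B -> code_adj k B A.
  by rewrite /code_adj /= eq_sym capvC.
case: (mx (fun C => codes_above k S C \/ C = D)).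
  split; first by exists C0; left.
    by move=> C [[]|->] //; split=> //; apply/(projectiveP _ n1).
  move=> A B [AS|->] [BS|->] // AB.
  - exact: cl.
  - exact/symadj/DC.
  - exact: DC.
split; first by move=> C CS; left.
by move=> /(_ D (or_intror erefl)) [_ SD]; rewrite SD in nSD.
Qed.

(** A clique that properly contains the codes above [S] has a member [D] not above [S]. For [C]
    above [S], the spaces [S] and [D :&: C] are distinct hyperplanes of [C], so [C = S + D :&: C]
    lies in [D + S]; and [D + S] lies in [D + C], of dimension [k + 1]. *)
Lemma star_criterion k S : (1 < n)%N -> (0 < k)%N -> \dim S = (k - 1)%N ->
    (exists C, codes_above k S C) ->
    (forall D, \dim D = k -> unpinned D -> ~~ (S <= D)%VS ->
       (\dim (D + S) <= k.+1)%N ->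
       (forall C, codes_above k S C -> (C <= D + S)%VS) -> False) ->
  is_star k S.
Proof.
move=> n1 k0 dS ne hD; split.
  split=> //; first by move=> C [].
  move=> A B /(codes_aboveP _ _ _ n1)[dA _ SA] /(codes_aboveP _ _ _ n1)[dB _ SB] /eqP AB.
  by apply: code_adjI => //; rewrite -dS dimvS // subv_cap SA.
move=> B [_ Bp cl] [AB nBA]; apply: nBA => D BD.
have [dD /(projectiveP _ n1) uD] := Bp D BD.
have [SD|nSD] := boolP (S <= D)%VS; first by apply/codes_aboveP.
exfalso; apply: (hD D dD uD nSD).
  case: ne => C CS; have BC := AB _ CS.
  have [dC _ SC] := (codes_aboveP k S C n1).1 CS.
  have : code_adj k D C.
    by apply: cl => // DC; rewrite DC SC in nSD.
  case/andP=> _ /eqP dDC.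
  have := dimv_sum_cap D S; rewrite dD dS.
  have : (\dim (D + C) <= k.+1)%N by have := dimv_sum_cap D C; rewrite dD dC dDC; lia.
  have /dimvS : (D + S <= D + C)%VS by rewrite addvS.
  by lia.
move=> C CS; have [dC _ SC] := (codes_aboveP k S C n1).1 CS.
have /andP[_ /eqP dDC] : code_adj k D C.
  by apply: cl (AB _ CS) _ => // DC; rewrite DC SC in nSD.
have sub : (S + D :&: C <= C)%VS by rewrite subv_add SC capvSr.
have /eqP <- : (S + D :&: C == C)%VS.
  rewrite eqEdim sub dC; rewrite leqNgt; apply: contra nSD => lt.
  have /eqP e : (S == S + D :&: C)%VS by rewrite eqEdim addvSl dS; lia.
  have : (D :&: C <= S)%VS by rewrite e addvSr.
  move=> DCS; have /eqP -> : (S == D :&: C)%VS by rewrite eq_sym eqEdim DCS dS dDC /=.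
  exact: capvSl.
by rewrite addvC addvS ?capvSl.
Qed.

End Coordinates.

(** * Arithmetic in fields with two and three elements *)

Section SmallFields.
Variable F : finFieldType.
Implicit Types x y z : F.

(** Translation by 1 permutes the field, so the sums of [x] and of [x + 1] over all [x] agree. *)
Lemma card_natr_eq0 : #|F|%:R = 0 :> F.
Proof.
have e : \sum_(x : F) x = \sum_(x : F) (x + 1) by apply: reindex_inj; apply: addIr.
move: e; rewrite big_split /= sumr_const => /eqP.
by rewrite -[X in X == _]addr0 (inj_eq (addrI _)) eq_sym => /eqP.
Qed.

Lemma card2_neq0 x : #|F| = 2%N -> x != 0 -> x = 1.
Proof.
move=> q2 x0; have := expf_card x; rewrite q2 expr2 => e.
by apply: (mulIf x0); rewrite e mul1r.
Qed.

Lemma card2_addrr x : #|F| = 2%N -> x + x = 0.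
Proof.
by move=> q2; have := card_natr_eq0; rewrite q2 => e; rewrite -mulr2n -mulr_natr e mulr0.
Qed.

Lemma card3_addr x : #|F| = 3%N -> x + x + x = 0.
Proof.
move=> q3; have := card_natr_eq0; rewrite q3 => e.
have -> : x + x + x = x * 3%:R by ring.
by rewrite e mulr0.
Qed.

Lemma card3_neq0 x y : #|F| = 3%N -> x != 0 -> y != 0 -> x = y \/ x = - y.
Proof.
move=> q3.
have sq z : z != 0 -> z * z = 1.
  move=> z0; have := expf_card z; rewrite q3 => e.
  by apply: (mulIf z0); rewrite mul1r -[RHS]e; ring.
move=> /sq x2 /sq y2.
have /eqP : (x - y) * (x + y) = 0.
  have -> : (x - y) * (x + y) = x * x - y * y by ring.
  by rewrite x2 y2 subrr.
rewrite mulf_eq0 subr_eq0 addr_eq0.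
by case/orP=> /eqP; [left | right].
Qed.

(** The differences [x - y] and [y - z] are equal or opposite. Opposite differences give [x = z];
    equal ones give an arithmetic progression, whose sum is [3 y = 0]. *)
Lemma card3_distinct_sum x y z : #|F| = 3%N -> x != y -> y != z -> x != z ->
  x + y + z = 0.
Proof.
move=> q3 xy yz xz.
have [||e|e] := @card3_neq0 (x - y) (y - z) q3; rewrite ?subr_eq0 //.
  by rewrite -(card3_addr y q3) -[x](subrK y) e; ring.
by case/eqP: xz; rewrite -[x](subrK y) e; ring.
Qed.

Lemma card3_sum_eq0 x y z : #|F| = 3%N -> x != 0 -> y != 0 -> z != 0 ->
  x + y + z = 0 -> x = y.
Proof.
move=> q3 x0 y0 z0; have [//|->] := card3_neq0 q3 x0 y0.
by rewrite addNr add0r => /eqP; rewrite (negPf z0).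
Qed.

End SmallFields.

(** * Codes above [S], described by functions on the column classes *)

Section Classes.
Variables (F : finFieldType) (n k : nat) (S : {vspace 'rV[F]_n}) (j0 : 'I_n).
(* [r i] is a chosen representative of the class of column [i], and
   [lam i] the scalar by which column [i] is a multiple of column [r i]. *)
Variables (r : 'I_n -> 'I_n) (lam : 'I_n -> F).
Hypotheses (n1 : (1 < n)%N) (k1 : (1 < k)%N) (dS : \dim S = (k - 1)%N).
Hypotheses (lam0 : forall i, lam i != 0).
Hypotheses (rS : forall s i, s \in S -> s 0 i = lam i * s 0 (r i)).
Hypotheses (S0 : forall s, s \in S -> s 0 j0 = 0).
Hypotheses (Sn0 : forall i, i != j0 -> exists2 s, s \in S & s 0 i != 0).
Hypotheses (rpin : forall i j c, i != j0 -> j != j0 -> pinned S i j c -> r i = r j).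
Hypotheses (rr : forall i, r (r i) = r i) (rj0 : forall i, (r i == j0) = (i == j0)).

Notation q := #|F|.
Implicit Types (g : 'I_n -> F) (C D W : {vspace 'rV[F]_n}) (v w : 'rV[F]_n).

Definition class_of i : {set 'I_n} := [set j | r j == r i].

Definition separating g := forall i j, i != j -> i != j0 -> r i = r j -> g i != g j.

(** Columns of one class agree on [S] after division by [lam], so [g] records the rescaled entries
    of the added vector; the entry at [j0] is normalized to 1. *)
Definition extension g : 'rV[F]_n :=
  \row_j (if j == j0 then 1 else lam j * g j).

Lemma rr_j0 : r j0 = j0.
Proof. by apply/eqP; rewrite rj0. Qed.

Lemma class_neq_j0 i j : r i = r j -> i != j0 -> j != j0.
Proof. by rewrite -(rj0 i) -(rj0 j) => ->. Qed.

(** A pinning of the sum restricts to [S]. Away from [j0] it puts [i] and [j] in one class with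
    [c = lam j / lam i], and evaluating it at [extension g] gives [g i = g j]. *)
Lemma extension_code g : separating g -> codes_above k S (S + <[extension g]>)%VS.
Proof.
move=> hg; apply/codes_aboveP => //; split; last exact: addvSl.
  have e0 : extension g \notin S.
    by apply/negP => /S0; rewrite mxE eqxx => /eqP; rewrite oner_eq0.
  by rewrite dim_addv_line // dS; move: k1; clear; lia.
move=> i j c ij pin.
have pS : pinned S i j c := pinnedS (addvSl _ _) pin.
have := pin _ (subvP (addvSr S _) _ (memv_line _)); rewrite !mxE.
have [jj|jj] := eqVneq j j0.
  have [ii|ii] := eqVneq i j0; first by rewrite jj ii eqxx in ij.
  have [s sS si] := Sn0 ii; have := pS s sS; rewrite jj S0 // => /eqP.
  rewrite eq_sym mulf_eq0 (negPf si) orbF => /eqP ->; rewrite mul0r => /eqP.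
  by rewrite oner_eq0.
have [s sS sj] := Sn0 jj.
have [ii|ii] := eqVneq i j0.
  by case/eqP: sj; rewrite (pS s sS) ii S0 // mulr0.
have rij := rpin ii jj pS.
have : lam j = c * lam i.
  have := pS s sS; rewrite (rS j) // (rS i) // rij mulrA.
  apply: mulIf; apply: contraNneq sj => e; by rewrite rS // e mulr0.
move=> e; rewrite mulrA -e => /(mulfI (lam0 j)) /esym/eqP; apply/negP.
exact: hg.
Qed.

Lemma extension_mem W g : (forall C, codes_above k S C -> (C <= W)%VS) ->
  separating g -> extension g \in W.
Proof.
move=> CW hg; have := CW _ (extension_code hg); rewrite subv_add => /andP[_].
by rewrite -memvE.
Qed.

(** Converse to [extension_code]: here [C = S + <[v]>], and a violation by [v] would extend a
    coordinate relation from [S] to all of [C]. *)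
Lemma code_separating C v : codes_above k S C -> v \in C -> v \notin S ->
  v 0 j0 != 0 /\ forall i j, i != j -> i != j0 -> r i = r j ->
    v 0 i / lam i != v 0 j / lam j.
Proof.
move=> /codes_aboveP -/(_ n1)[dC uC SC] vC vS.
have defC : C = (S + <[v]>)%VS.
  apply/esym/eqP; rewrite eqEdim subv_add SC -memvE vC /= dC.
  rewrite -(subnKC (ltnW k1)) addnC addn1 -dS ltnNge; apply: contra vS => dSv.
  by have /eqP -> : (S == S + <[v]>)%VS; [rewrite eqEdim addvSl | rewrite (subvP (addvSr _ _)) ?memv_line].
have pin i j c : pinned S i j c -> v 0 j = c * v 0 i -> pinned C i j c.
  move=> pS pv w; rewrite defC => /memv_addP[s sS [_ /vlineP[t ->] ->]].
  by rewrite !mxE (pS _ sS) pv; ring.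
split.
  apply/eqP => v0.
  have [i ij] := exists_ord_neq j0 n1.
  by apply: (uC i j0 0 ij); apply: pin => [s /S0|]; rewrite mul0r.
move=> i j ij ii rij; apply/eqP => e.
apply: (uC i j (lam j / lam i) ij); apply: pin => [s sS|].
  by rewrite (rS j) // (rS i) // rij mulrA divfK.
by rewrite mulrAC -mulrA e mulrC divfK.
Qed.

Lemma code_outside C : codes_above k S C -> exists2 v, v \in C & v \notin S.
Proof.
case/codes_aboveP => // dC _ SC.
have : ~~ (C <= S)%VS by apply/negP => /dimvS; rewrite dC dS; lia.
by case/subvPn => v; exists v.
Qed.

(** The rescaled entries of a vector of [C] outside [S] embed the class into [F]. *)
Lemma code_class_size C i : codes_above k S C -> (#|class_of i| <= q)%N.
Proof.
move=> CS; have [v vC vS] := code_outside CS.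
have [_ hv] := code_separating CS vC vS.
have inj : {in class_of i &, injective (fun j => v 0 j / lam j)}.
  move=> a b; rewrite !inE => /eqP ra /eqP rb /eqP.
  apply: contraTeq => ab.
  have [aj|aj] := eqVneq a j0; last by apply: hv; rewrite // ra rb.
  have := rj0 b; rewrite rb -ra aj rr_j0 eqxx => /esym/eqP bj.
  by rewrite aj bj eqxx in ab.
by rewrite -(card_in_imset inj) max_card.
Qed.

Lemma exists_separating : (forall i, #|class_of i| <= q)%N -> exists g, separating g.
Proof.
(* The [m]-th column of a class gets the [m]-th element of [F]. *)
move=> hq; exists (fun i => nth 0 (enum F) (index i (enum (class_of i)))).
move=> i j ij ii rij.
have ci : class_of j = class_of i by apply/setP => l; rewrite !inE rij.
have ji : j \in class_of i by rewrite inE rij.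
have ilt l : l \in class_of i -> (index l (enum (class_of i)) < size (enum F))%N.
  move=> li; rewrite -cardE (leq_trans _ (hq i)) // [X in (_ < X)%N]cardE.
  by rewrite index_mem mem_enum.
rewrite ci nth_uniq ?enum_uniq ?ilt ?inE ?rij //.
apply: contra ij => /eqP e; apply/eqP; by apply: (index_inj i _ _ e); rewrite mem_enum inE ?rij.
Qed.

(* The difference of the extensions of two separating functions that differ at
   one place, or by a transposition. *)
Lemma exists_isolating W (J : {set 'I_n}) g i : (forall C, codes_above k S C -> (C <= W)%VS) ->
    separating g -> j0 \notin J -> i \in J ->
    (#|class_of i| < q)%N \/ (exists2 j, j \in class_of i & j \notin J) ->
  exists w, [/\ w \in W, w 0 i != 0, w 0 j0 = 0 & forall j, j \in J -> j != i -> w 0 j = 0].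
Proof.
move=> CW hg j0J iJ hi.
have ii : i != j0 by apply: contraNneq j0J => <-.
suff [g' [hg' g'i g'J]] : exists g', [/\ separating g', g' i != g i
    & forall j, j \in J -> j != i -> g' j = g j].
  exists (extension g' - extension g); split.
  - by rewrite memvB ?extension_mem.
  - by rewrite !mxE (negPf ii) -mulrBr mulf_neq0 // subr_eq0.
  - by rewrite !mxE eqxx subrr.
  - move=> j jJ ji; rewrite !mxE g'J // subrr //.
case: hi => [lt|[j]]; last first.
  rewrite inE => /eqP rji jJ.
  have ji : j != i by apply: contraNneq jJ => ->.
  have rt l : r (tperm i j l) = r l by case: tpermP => [->|->|//].
  exists (fun l => g (tperm i j l)); split.
  - move=> a b ab aj rab; apply: hg; rewrite ?rt // ?(inj_eq perm_inj) //.
    by rewrite -rj0 rt rj0.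
  - by rewrite tpermL; apply: hg => //; apply: class_neq_j0 ii.
  - move=> l lJ li; rewrite tpermD //; first by rewrite eq_sym.
    by apply: contraNneq jJ => ->.
have [y yn] : exists y, y \notin g @: class_of i.
  apply/existsP; rewrite -[[exists _, _]]negbK negb_exists; apply/negP => /forallP a.
  suff : (q <= #|class_of i|)%N by rewrite leqNgt lt.
  rewrite (leq_trans _ (leq_imset_card g _)) // -cardsT subset_leq_card //.
  by apply/subsetP => z _; have := a z; rewrite negbK.
exists (fun l => if l == i then y else g l); split.
- move=> a b ab aj rab.
  have [ai|ai] := eqVneq a i.
    rewrite ai eq_sym in ab; rewrite (negPf ab).
    by apply: contraNneq yn => ->; rewrite imset_f // inE -rab ai.
  have [bi|bi] := eqVneq b i; last exact: hg.
  by apply: contraNneq yn => <-; rewrite imset_f // inE rab bi.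
- by rewrite eqxx; apply: contraNneq yn => ->; rewrite imset_f // inE.
- by move=> j _ /negPf ->.
Qed.

(** In a relation on [W] among the coordinates in [J] and at [j0], isolating vectors kill the
    coefficients on [J], and the entry 1 of an extension kills the one at [j0]. The bound on [J]
    leaves a free value of [F] for a class inside [J]; any other class has a column outside [J] to
    exchange with. *)
Lemma span_codes_dim W (J : {set 'I_n}) : (forall C, codes_above k S C -> (C <= W)%VS) ->
    (forall i, #|class_of i| <= q)%N -> j0 \notin J ->
    (forall i, i \in J -> #|J :&: class_of i| < q)%N ->
  (#|J| < \dim W)%N.
Proof.
move=> CW hq j0J hJ; have [g hg] := exists_separating hq.
have cJ : #|j0 |: J| = #|J|.+1 by rewrite cardsU1 j0J.
rewrite leqNgt; apply/negP => lt.
have [|a [j jJ aj] ha] := @exists_relation _ _ W (j0 |: J); first by rewrite cJ.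
have aJ i : i \in J -> a i = 0.
  move=> iJ.
  have [|w [wW wi wj0 wJ]] := exists_isolating CW hg j0J iJ.
    have [sub|/subsetPn[j' j'1 j'2]] := boolP (class_of i \subset J); last by right; exists j'.
    by left; rewrite -(setIidPr sub) hJ.
  have := ha w wW; rewrite (bigD1 i) ?inE ?iJ ?orbT //= big1 => [|l].
    by rewrite addr0 => /eqP; rewrite mulf_eq0 (negPf wi) orbF => /eqP.
  rewrite !inE => /andP[/orP[/eqP ->|lJ] li]; first by rewrite wj0 mulr0.
  by rewrite wJ // mulr0.
have := ha _ (extension_mem CW hg); rewrite (bigD1 j0) ?setU11 //= big1 => [|l].
  rewrite addr0 mxE eqxx mulr1 => a0.
  by case/setU1P: jJ aj => [->|/aJ ->]; rewrite ?a0 eqxx.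
rewrite !inE => /andP[/orP[->//|lJ] _]; by rewrite aJ // mul0r.
Qed.

Lemma star_of_transversal (J : {set 'I_n}) : (forall i, #|class_of i| <= q)%N -> j0 \notin J ->
    (forall i, i \in J -> #|J :&: class_of i| < q)%N -> (k < #|J|)%N ->
  is_star k S.
Proof.
move=> hq j0J hJ kJ; apply: star_criterion => //; first by lia.
  by have [g /extension_code] := exists_separating hq; eexists; eassumption.
move=> D _ _ _ dDS CDS; have := span_codes_dim CDS hq j0J hJ.
by lia.
Qed.

(** By [span_codes_dim] the space [(D + S) :&: H] has dimension at least [k + 1], the most that
    [D + S] can have; so [D] lies in [H] and must contain [S]. *)
Lemma star_of_subspace H (J : {set 'I_n}) : (forall i, #|class_of i| <= q)%N -> j0 \notin J ->
    (forall i, i \in J -> #|J :&: class_of i| < q)%N -> (k <= #|J|)%N ->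
    (forall C, codes_above k S C -> (C <= H)%VS) ->
    (forall D, \dim D = k -> unpinned D -> (D <= H)%VS -> (S <= D)%VS) ->
  is_star k S.
Proof.
move=> hq j0J hJ kJ CH DH; apply: star_criterion => //; first by lia.
  by have [g /extension_code] := exists_separating hq; eexists; eassumption.
move=> D dD uD nSD dDS CDS.
have CWH C : codes_above k S C -> (C <= (D + S) :&: H)%VS.
  by move=> CS; rewrite subv_cap CDS ?CH.
have lt := span_codes_dim CWH hq j0J hJ.
have /eqP e : ((D + S) :&: H == D + S)%VS by rewrite eqEdim capvSl /=; lia.
by case/negP: nSD; apply: DH => //; apply: subv_trans (addvSl D S) _; rewrite -e capvSr.
Qed.

(** * Representatives of the classes, and stars with a large span *)

Definition reps : {set 'I_n} := [set i | (r i == i) && (i != j0)].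
Definition nonreps : {set 'I_n} := [set i | r i != i].

Lemma rep_mem i : i != j0 -> r i \in reps.
Proof. by move=> ii; rewrite inE rr eqxx rj0. Qed.

Lemma dim_le_reps : (k - 1 <= #|reps|)%N.
Proof.
rewrite -dS; apply: dim_le_coords => v vS vR; apply/rowP => i; rewrite mxE.
have [->|ii] := eqVneq i j0; first exact: S0.
by rewrite rS // vR ?mulr0 ?rep_mem.
Qed.

Lemma card_reps_nonreps : (#|reps| + #|nonreps|).+1 = n.
Proof.
rewrite -[RHS]card_ord -cardsT [RHS](cardsD1 j0) inE add1n.
congr _.+1; rewrite -[RHS](cardsID reps); congr (_ + _)%N; apply: eq_card => i; rewrite !inE /=;
  by case: (eqVneq i j0) => [->|]; rewrite ?rr_j0 ?eqxx //= ?andbF ?andbT ?orbF.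
Qed.

(** Here [J] is [reps] together with [X]: a class contributes its representative and its part of
    [X]. *)
Lemma star_of_nonreps (X : {set 'I_n}) : (forall i, #|class_of i| <= q)%N ->
    X \subset nonreps -> (forall i, #|X :&: class_of i|.+1 < q)%N ->
    (k < #|reps| + #|X|)%N ->
  is_star k S.
Proof.
move=> hq XN hX kX; have dRX : [disjoint reps & X].
  apply/pred0P => i; rewrite /= inE; apply/negbTE; rewrite -andbA; apply/negP.
  by case/and3P=> ri _ /(subsetP XN); rewrite inE ri.
apply: (star_of_transversal (J := reps :|: X)) => //.
- rewrite !inE eqxx andbF /=; apply/negP => /(subsetP XN).
  by rewrite inE rr_j0 eqxx.
- move=> i _; apply: leq_ltn_trans (hX i); rewrite setIUl.
  rewrite (leq_trans (leq_card_setU _ _)) // -add1n leq_add2r -(cards1 (r i)).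
  apply: subset_leq_card; apply/subsetP => l; rewrite !inE.
  by case/andP=> /andP[/eqP rl _] /eqP <-; rewrite rl.
- by rewrite cardsU disjoint_setI0 // cards0 subn0.
Qed.

(** There are at least [k - 1] representatives, and for [q >= 4] any two further columns may be
    added. If fewer than two are available, all [n - 1 > k] columns other than [j0] are taken. *)
Lemma star_ge4 : (forall i, #|class_of i| <= q)%N -> (4 <= q)%N -> (k < n - 1)%N ->
  is_star k S.
Proof.
move=> hq q4 kn; have cRN := card_reps_nonreps; have dR := dim_le_reps.
have small (X : {set 'I_n}) : (#|X| <= 2)%N ->
    forall i, (#|X :&: class_of i|.+1 < q)%N.
  move=> X2 i; apply: leq_trans q4; rewrite !ltnS.
  by apply: leq_trans X2; apply/subset_leq_card/subsetIl.
have [N2|N1] := leqP 2 #|nonreps|; last first.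
  apply: (star_of_nonreps (X := nonreps)) => //; first exact: (small _ (ltnW N1)).
  by lia.
have [x [y [xN yN xy]]] := card_gt1P N2.
apply: (star_of_nonreps (X := [set x; y])) => //; rewrite ?cards2 ?xy; try by lia.
  by rewrite subUset !sub1set xN.
by apply: small; rewrite cards2 xy.
Qed.

Lemma star_nonrep x : (forall i, #|class_of i| <= q)%N -> (3 <= q)%N ->
  x \in nonreps -> (k <= #|reps|)%N -> is_star k S.
Proof.
move=> hq q3 xN kR; apply: (star_of_nonreps (X := [set x])) => //.
- by rewrite sub1set.
- move=> i; apply: leq_trans q3; rewrite !ltnS -(cards1 x).
  exact/subset_leq_card/subsetIl.
- by rewrite cards1; lia.
Qed.

(** At least [k - 1] representatives and two columns from different classes give at least [k + 1]
    positions, at most two in each class. *)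
Lemma star_two_classes x y : (forall i, #|class_of i| <= q)%N -> (3 <= q)%N ->
  x \in nonreps -> y \in nonreps -> r x != r y -> is_star k S.
Proof.
move=> hq q3 xN yN rxy; have xy : x != y by apply: contraNneq rxy => ->.
have dR := dim_le_reps.
apply: (star_of_nonreps (X := [set x; y])) => //; rewrite ?cards2 ?xy; try by lia.
  by rewrite subUset !sub1set xN.
move=> i; apply: leq_trans q3; rewrite !ltnS.
apply/card_le1_eqP => a b; rewrite !inE => /andP[ha /eqP ra] /andP[hb /eqP rb].
case/orP: ha hb ra rb => /eqP -> /orP[] /eqP -> // ra rb; case/eqP: rxy;
  by rewrite ra rb.
Qed.

Lemma star_card2 : (forall i, #|class_of i| <= q)%N -> q = 2%N ->
  (k < #|reps|)%N -> is_star k S.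
Proof.
move=> hq q2 kR; apply: (star_of_nonreps (X := set0)) => //.
- exact: sub0set.
- by move=> i; rewrite set0I cards0 q2.
- by rewrite cards0 addn0.
Qed.

Lemma code_eq_or_separating C v : codes_above k S C -> v \in C ->
  v \in S \/ v 0 j0 != 0 /\ forall i j, i != j -> i != j0 -> r i = r j ->
    v 0 i / lam i != v 0 j / lam j.
Proof.
move=> CS vC; have [vS|vS] := boolP (v \in S); [by left|by right; exact: (code_separating CS vC vS)].
Qed.

Lemma functional_S s i : s \in S -> s 0 i / lam i = s 0 (r i).
Proof. by move=> sS; rewrite rS // mulrAC divff // mul1r. Qed.

(** * Ternary codes with a class of three columns *)

Section TripleClass.
Variables (a b c : 'I_n).
Hypotheses (q3 : q = 3%N) (hq : forall i, (#|class_of i| <= q)%N).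
Hypotheses (aj0 : a != j0) (ab : a != b) (bc : b != c) (ac : a != c).
Hypotheses (rab : r a = r b) (rac : r a = r c).

(** This form vanishes on every code above [S]: on [S] the three rescaled values are equal, off [S]
    they are the three elements of [F], and both kinds of triple sum to 0 when [q = 3]. *)
Definition triple_sum v := v 0 a / lam a + v 0 b / lam b + v 0 c / lam c.

Lemma triple_class : class_of a = [set a; b; c].
Proof.
apply/esym/eqP; rewrite eqEcard; apply/andP; split.
  by apply/subsetP => i; rewrite !inE => /orP[/orP[]|] /eqP ->; rewrite ?rab -?rac ?rab.
apply: leq_trans (hq a) _; rewrite q3.
by rewrite setUC cardsU1 cards2 ab !inE !negb_or eq_sym ac eq_sym bc.
Qed.

Lemma triple_hyperplane : exists H : {vspace 'rV[F]_n}, [/\ (\dim H).+1 = n,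
    forall v, (v \in H) = (triple_sum v == 0)
  & forall C, codes_above k S C -> (C <= H)%VS].
Proof.
have hf : linear_functional triple_sum.
  by move=> t v w; rewrite /triple_sum !mxE; ring.
have [||H [_ dH hH]] := @hyperplane _ _ fullv triple_sum (\row_l (l == a)%:R) hf.
- exact: memvf.
- rewrite /triple_sum !mxE eqxx (eq_sym b) (eq_sym c) (negPf ab) (negPf ac).
  by rewrite !mul0r !addr0 mul1r invr_neq0.
have {}hH v : (v \in H) = (triple_sum v == 0) by rewrite hH memvf.
exists H; split=> //; first by rewrite dH dimvf /dim /= mul1n.
move=> C CS; apply/subvP => v vC; rewrite hH /triple_sum.
case: (code_eq_or_separating CS vC) => [vS|[_ hv]].
  by rewrite !functional_S // -rac -rab card3_addr.
have bj0 : b != j0 := class_neq_j0 rab aj0.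
by apply/eqP/card3_distinct_sum => //; apply: hv => //; rewrite -rab.
Qed.

(** A projective two-dimensional [D] in the hyperplane has a line of vectors that vanish at [j0]. A
    spanning vector [y] is nonzero elsewhere, and its three rescaled values sum to 0, which over
    three elements makes them equal; hence [y] spans [S]. *)
Lemma star_single_triple : k = 2%N -> (forall i, i != j0 -> r i = r a) ->
  is_star k S.
Proof.
move=> k2 one; have [H [_ hH CH]] := triple_hyperplane.
have cla := triple_class.
have bj0 : b != j0 := class_neq_j0 rab aj0.
have cj0 : c != j0 := class_neq_j0 rac aj0.
have all3 i : i != j0 -> [|| i == a, i == b | i == c].
  move=> /one ri; have : i \in class_of a by rewrite inE ri.
  by rewrite cla !inE orbA.
apply: (star_of_subspace (H := H) (J := [set a; b])) => //.
- by rewrite !inE !(eq_sym j0) (negPf aj0) (negPf bj0).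
- move=> i _; rewrite q3 ltnS (leq_trans (subset_leq_card (subsetIl _ _))) //.
  by rewrite cards2; case: eqP.
- by rewrite cards2 ab k2.
move=> D dD uD DH.
have hf : linear_functional (fun v : 'rV[F]_n => v 0 j0) by move=> t v w; rewrite !mxE.
have [x xD xj0] := unpinned_neq0 j0 n1 uD.
have [D0 [D0D dD0 hD0]] := hyperplane hf xD xj0.
have {}dD0 : \dim D0 = 1%N by apply: succn_inj; rewrite dD0 dD k2.
have [y yD0 y0] : exists2 y, y \in D0 & y != 0.
  exists (vpick D0); first exact: memv_pick.
  by rewrite vpick0 -dimv_eq0 dD0.
have defD0 : D0 = <[y]>%VS.
  by apply/esym/eqP; rewrite eqEdim -memvE yD0 dim_vline y0 dD0.
have /andP[yD /eqP yj0] : (y \in D) && (y 0 j0 == 0) by rewrite -hD0.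
(* If [y] vanished at [i], coordinate [i] would be a multiple of coordinate [j0] on [D]. *)
have yi i : i != j0 -> y 0 i != 0.
  move=> ii; apply/eqP => yi; apply: (uD j0 i (x 0 i / x 0 j0)); first by rewrite eq_sym.
  move=> v vD; have : v - (v 0 j0 / x 0 j0) *: x \in D0.
    by rewrite hD0 memvB ?memvZ //= !mxE divfK // subrr.
  rewrite defD0 => /vlineP[t vE].
  have -> : v = t *: y + (v 0 j0 / x 0 j0) *: x by rewrite -vE subrK.
  by rewrite !mxE yi yj0; field.
have usum : triple_sum y = 0 by apply/eqP; rewrite -hH (subvP DH).
have un i : i != j0 -> y 0 i / lam i != 0 by move=> ii; rewrite mulf_neq0 ?invr_eq0 ?yi.
have yab : y 0 a / lam a = y 0 b / lam b by apply: card3_sum_eq0 usum; rewrite ?un.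
have yac : y 0 a / lam a = y 0 c / lam c.
  apply: (card3_sum_eq0 (z := y 0 b / lam b)); rewrite ?un //.
  by rewrite -usum /triple_sum; ring.
have [s sS sa] := Sn0 aj0.
have s0 : s != 0 by apply: contraNneq sa => ->; rewrite mxE.
have defS : S = <[s]>%VS.
  apply/esym/eqP; rewrite eqEdim -memvE sS dim_vline s0 dS k2 //.
rewrite defS -memvE.
suff -> : s = (s 0 a / y 0 a) *: y by rewrite memvZ.
apply/rowP => i; rewrite !mxE.
have [->|ii] := eqVneq i j0; first by rewrite yj0 S0 // mulr0.
have -> : y 0 i = lam i * (y 0 a / lam a).
  by case/or3P: (all3 i ii) => /eqP ->; [|rewrite yab|rewrite yac]; rewrite mulrC divfK.
rewrite (rS i) // (rS a) // (one i ii).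
by field; rewrite yi // lam0.
Qed.

(** All codes above [S] lie in [H], of dimension [k + 1], and [f] restricts to coordinate [e] on
    [S]. The unit vectors at [e] and [j0] leave only these two positions for [i] and [j]; a vector
    supported on [a] and [b] then has [f = 2], which is nonzero. *)
Lemma not_star_single_triple e : n = k.+2 -> e \in reps -> e != r a -> ~ is_star k S.
Proof.
move=> nk eR era; have [H [dH hH CH]] := triple_hyperplane.
have /andP[/eqP re ej0] : (r e == e) && (e != j0) by rewrite inE in eR.
have bj0 : b != j0 := class_neq_j0 rab aj0.
have ne i : r i = r a -> i != e by move=> ri; apply: contraNneq era => ie; rewrite -ri ie re.
have [s sS se] := Sn0 ej0.
pose f v := v 0 a / lam a - v 0 b / lam b + v 0 e + v 0 j0.
have hf : linear_functional f by move=> t v w; rewrite /f !mxE; ring.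
have ae := ne a erefl; have be := ne b (esym rab); have ce := ne c (esym rac).
have cj0 : c != j0 := class_neq_j0 rac aj0.
apply: (not_star (W := H) (f := f) (x := s)) => //.
- exact: ltnW.
- by rewrite /f !functional_S // -rab subrr add0r S0 // addr0.
- by apply: succn_inj; rewrite dH nk.
move=> i j t u ij u0 pin.
have eij : (j == e) || (i == e).
  pose w : 'rV[F]_n := \row_l (l == e)%:R.
  have := pin w.
  rewrite hH /triple_sum /f !mxE eqxx (negPf ae) (negPf be) (negPf ce).
  rewrite (eq_sym j0) (negPf ej0) /= !mul0r !addr0 subr0 add0r mulr1.
  move=> /(_ (eqxx _)); case: eqP => // _; case: eqP => //= _.
  by rewrite mulr0 subr0 => /esym/eqP; rewrite (negPf u0).
have jij : (j == j0) || (i == j0).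
  pose w : 'rV[F]_n := \row_l (l == j0)%:R.
  have := pin w.
  rewrite hH /triple_sum /f !mxE eqxx (negPf aj0) (negPf bj0) (negPf cj0).
  rewrite (negPf ej0) /= !mul0r !addr0 subr0 add0r mulr1.
  move=> /(_ (eqxx _)); case: eqP => // _; case: eqP => //= _.
  by rewrite mulr0 subr0 => /esym/eqP; rewrite (negPf u0).
have not_ab l : (l == e) || (l == j0) -> (l != a) && (l != b).
  by case/orP=> /eqP ->; rewrite ?(eq_sym e a) ?(eq_sym e b) ?(eq_sym j0 a) ?(eq_sym j0 b) ?ae ?be ?aj0 ?bj0.
have lj : (j == e) || (j == j0).
  case/orP: eij => [->//|/eqP ie]; case/orP: jij => [->|/eqP ij0']; first by rewrite orbT.
  by case/eqP: ej0; rewrite -ie ij0'.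
have li : (i == e) || (i == j0).
  case/orP: eij => [/eqP je|->//]; case/orP: jij => [/eqP jj|->]; last by rewrite orbT.
  by case/eqP: ej0; rewrite -je jj.
have /andP[ja jb] := not_ab j lj; have /andP[ia ib] := not_ab i li.
pose w : 'rV[F]_n := \row_l (lam l * ((l == a)%:R - (l == b)%:R)).
have := pin w.
rewrite hH /triple_sum /f !mxE !eqxx (negPf ja) (negPf jb) (negPf ia) (negPf ib).
rewrite (negPf ab) (eq_sym b a) (negPf ab) !(eq_sym c) (negPf ac) (negPf bc).
rewrite !(eq_sym e) (negPf ae) (negPf be) !(eq_sym j0) (negPf aj0) (negPf bj0).
rewrite /= !subr0 !mulr0 !addr0 mul0r subr0 addr0 sub0r mulr1 mulrN1 mulNr !divff // opprK.
rewrite subrr => /(_ (eqxx _)) /esym/eqP; rewrite mulf_eq0 (negPf u0) /= => /eqP e2.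
by have := card3_addr (1 : F) q3; rewrite e2 add0r => /eqP; rewrite oner_eq0.
Qed.

End TripleClass.

(** * Binary codes *)

Section Binary.
Hypotheses (q2 : q = 2%N) (hq : forall i, (#|class_of i| <= q)%N).

Lemma lam_binary i : lam i = 1.
Proof. exact: card2_neq0. Qed.

Lemma class_pair i j l : i != j -> r i = r j -> r i = r l -> l = i \/ l = j.
Proof.
move=> ij rij ril; have [->|li] := eqVneq l i; first by left.
have [->|lj] := eqVneq l j; first by right.
have := hq i; rewrite leqNgt q2; case/negP.
apply: (@leq_trans #|[set l; i; j]|).
  by rewrite setUC cardsU1 cards2 !inE !negb_or eq_sym lj eq_sym ij li.
apply/subset_leq_card/subsetP => a.
by rewrite !inE => /orP[/orP[]|] /eqP ->; rewrite -?ril -?rij.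
Qed.

Definition in_binary_span v := [forall i, v 0 i == v 0 (r i) + (r i != i)%:R * v 0 j0].

(** For [c] in [reps] these vectors, together with [nonrep_vec], are dual to the coordinates in
    [reps] and at [j0]; they serve as test vectors for linear forms. *)
Definition class_vec c : 'rV[F]_n := \row_l (r l == c)%:R.

Definition nonrep_vec : 'rV[F]_n := \row_l ((r l != l) || (l == j0))%:R.

Lemma class_vec_in c : c \in reps -> in_binary_span (class_vec c).
Proof.
rewrite inE => /andP[_ cj]; apply/forallP => i; rewrite !mxE rr rr_j0.
by rewrite (eq_sym j0) (negPf cj) /= mulr0 addr0.
Qed.

Lemma nonrep_vec_in : in_binary_span nonrep_vec.
Proof.
apply/forallP => i; rewrite !mxE rr rj0 !eqxx orbT mulr1 /=.
have [->|ii] := eqVneq i j0; first by rewrite rr_j0 eqxx /= addr0.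
by rewrite orbF add0r.
Qed.

(* For q = 2 a class has at most two columns, and the values of v on them differ
   by v j0; so the representatives and j0 are coordinates on the span. *)
Lemma binary_span : exists Z : {vspace 'rV[F]_n}, [/\ \dim Z = #|reps|.+1,
    forall v, (v \in Z) = in_binary_span v
  & forall C, codes_above k S C -> (C <= Z)%VS].
Proof.
have [||Z hZ] := @vspace_of_pred F n in_binary_span.
- by apply/forallP => i; rewrite !mxE mulr0 addr0.
- move=> t v w /forallP hv /forallP hw; apply/forallP => i; rewrite !mxE.
  by rewrite (eqP (hv i)) (eqP (hw i)); apply/eqP; ring.
have cJ : #|j0 |: reps| = #|reps|.+1 by rewrite cardsU1 inE eqxx andbF.
exists Z; split=> //.
  apply/eqP; rewrite eqn_leq -cJ; apply/andP; split.
    apply: dim_le_coords => v; rewrite hZ => /forallP hv v0; apply/rowP => i.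
    rewrite (eqP (hv i)) !mxE (v0 j0) ?setU11 // mulr0 addr0.
    have [->|ii] := eqVneq i j0; first by rewrite rr_j0 v0 ?setU11.
    by rewrite v0 // in_setU1 rep_mem ?orbT.
  rewrite leqNgt; apply/negP => /exists_relation[a [j jJ aj] ha].
  have aR c : c \in reps -> a c = 0.
    move=> cR; have := ha (class_vec c); rewrite hZ class_vec_in // => /(_ isT).
    have cj : c != j0 by move: cR; rewrite inE => /andP[].
    have rc : r c = c by move: cR; rewrite inE => /andP[/eqP].
    rewrite (bigD1 c) ?in_setU1 ?cR ?orbT //= mxE rc eqxx mulr1 big1 ?addr0 // => l.
    rewrite mxE !inE => /andP[/orP[/eqP ->|/andP[/eqP -> _]] /negPf lc].
      by rewrite rr_j0 lc /= mulr0.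
    by rewrite lc /= mulr0.
  have aj0 : a j0 = 0.
    have := ha nonrep_vec; rewrite hZ nonrep_vec_in => /(_ isT).
    rewrite (bigD1 j0) ?setU11 //= mxE eqxx orbT mulr1 big1 ?addr0 // => l.
    by rewrite in_setU1 => /andP[/orP[->//|/aR ->] _]; rewrite mul0r.
  by case/setU1P: jJ aj => [->|/aR ->]; rewrite ?aj0 eqxx.
move=> C CS; apply/subvP => v vC; rewrite hZ; apply/forallP => i.
case: (code_eq_or_separating CS vC) => [vS|[v0 hv]].
  by rewrite {1}rS // lam_binary mul1r (S0 vS) mulr0 addr0.
rewrite (card2_neq0 q2 v0) mulr1.
have [ri|ri] := eqVneq (r i) i; first by rewrite ri addr0.
have ii : i != j0 by apply: contraNneq ri => ->; rewrite rr_j0.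
rewrite eq_sym in ri; have := hv i (r i) ri ii (esym (rr i)).
rewrite !lam_binary !divr1 -subr_eq0 => /(card2_neq0 q2) e.
by apply/eqP; rewrite -[LHS](subrK (v 0 (r i))) e addrC.
Qed.

(** For [k = 2] the code [S] is a line, on which all coordinates other than [j0] are
    proportional. *)
Lemma one_rep i j : k = 2%N -> i != j0 -> j != j0 -> r i = r j.
Proof.
move=> k2 ii jj; have [s sS si] := Sn0 ii.
have s0 : s != 0 by apply: contraNneq si => ->; rewrite mxE.
have defS : S = <[s]>%VS.
  by apply/esym/eqP; rewrite eqEdim -memvE sS dim_vline s0 dS k2.
apply: (rpin (c := s 0 j / s 0 i)) => // v; rewrite defS => /vlineP[t ->].
by rewrite !mxE; field.
Qed.

(** In characteristic 2 the sum vanishes on [S] only if the two columns are equal, hence in one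
    class. *)
Lemma reps_neq c d : c \in reps -> d \in reps -> c != d ->
  exists2 s, s \in S & s 0 c + s 0 d != 0.
Proof.
rewrite !inE => /andP[/eqP rc cj] /andP[/eqP rd dj] cd.
have : ~~ [forall s, (s \in S) ==> (s 0 c + s 0 d == 0)].
  apply: contra cd => /forallP h; apply/eqP; rewrite -rc -rd.
  apply: (rpin (c := 1)) => // s sS; rewrite mul1r.
  have := h s; rewrite sS /= => /eqP e.
  by rewrite -[LHS]add0r -(card2_addrr (s 0 c) q2) -addrA e addr0.
by case/forallPn => s; rewrite negb_imply => /andP[]; exists s.
Qed.

(** The form is a sum of the coordinates at three representatives. It is 1 on their three class
    vectors, while a combination of two coordinates is nonzero on at most two class vectors. *)
Lemma not_star_four_reps : #|reps| = k -> (4 <= k)%N -> ~ is_star k S.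
Proof.
move=> Rk k4; have [Z [dZ hZ CZ]] := binary_span.
suff [c [d [e [s [[cR dR eR] [cd ce de] sS se]]]]] : exists c d e s,
    [/\ [/\ c \in reps, d \in reps & e \in reps],
        [/\ c != d, c != e & d != e], s \in S & s 0 c + s 0 d + s 0 e != 0].
  pose f (v : 'rV[F]_n) := v 0 c + v 0 d + v 0 e.
  have hf : linear_functional f by move=> t v w; rewrite /f !mxE; ring.
  apply: (not_star (W := Z) (f := f) (x := s)) => //.
  - exact: ltnW.
  - by rewrite dZ Rk.
  move=> i j t u ij u0 pin.
  have hit m : m \in reps -> f (class_vec m) = 1 -> (r j == m) || (r i == m).
    move=> mR fm; have := pin (class_vec m); rewrite hZ class_vec_in // fm !mxE mulr1.
    move=> /(_ isT); case: eqP => // _; case: eqP => //= _.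
    by rewrite mulr0 subr0 => /esym/eqP; rewrite (negPf u0).
  have rep_id m : m \in reps -> r m = m by rewrite inE => /andP[/eqP].
  have := hit c cR; rewrite /f !mxE (rep_id c cR) (rep_id d dR) (rep_id e eR) eqxx (eq_sym d) (eq_sym e) (negPf cd) (negPf ce) /= !addr0.
  move=> /(_ erefl) hc.
  have := hit d dR; rewrite /f !mxE (rep_id c cR) (rep_id d dR) (rep_id e eR) eqxx (negPf cd) (eq_sym e) (negPf de) /= add0r addr0.
  move=> /(_ erefl) hd.
  have := hit e eR; rewrite /f !mxE (rep_id c cR) (rep_id d dR) (rep_id e eR) eqxx (negPf ce) (negPf de) /= !add0r.
  move=> /(_ erefl) he.
  case/orP: hc => /eqP hc; case/orP: hd => /eqP hd; case/orP: he => /eqP he;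
    by move: cd ce de; rewrite -hc -hd -he eqxx.
have pick (A : {set 'I_n}) : (#|A| < k)%N -> exists2 c, c \in reps & c \notin A.
  move=> Ak; apply/subsetPn; apply: contraL Ak => /subset_leq_card.
  by rewrite Rk -leqNgt.
have [|c cR _] := pick set0; first by rewrite cards0 ltnW.
have [|d dR dc] := pick [set c]; first by rewrite cards1.
have [|e eR ecd] := pick [set c; d].
  by rewrite cards2 (leq_ltn_trans _ (ltnW k4)) //; case: (c != d).
have [|g gR gcde] := pick [set c; d; e].
  apply: leq_trans k4; rewrite ltnS (leq_trans (leq_card_setU _ _)) //.
  by rewrite cards1 cards2; case: (c != d).
move: dc ecd gcde; rewrite !inE !negb_or => dc /andP[ec ed] /andP[/andP[gc gd] ge].
(* A vector with different entries at [e] and [g] cannot have both sums over [c, d, e] and over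
   [c, d, g] equal to 0, so one of the two triples works. *)
have [|s sS hs] := reps_neq eR gR; first by rewrite eq_sym.
have [se|se] := eqVneq (s 0 c + s 0 d + s 0 e) 0; last first.
  by exists c, d, e, s; rewrite (eq_sym c d) (eq_sym c e) (eq_sym d e); split.
exists c, d, g, s; rewrite (eq_sym c d) (eq_sym c g) (eq_sym d g); split=> //.
apply: contra hs => /eqP sg; apply/eqP.
have -> : s 0 e + s 0 g = (s 0 c + s 0 d + s 0 e) + (s 0 c + s 0 d + s 0 g)
  - ((s 0 c + s 0 d) + (s 0 c + s 0 d)) by ring.
by rewrite se sg !card2_addrr // subr0.
Qed.

(** A combination of two coordinates that is nonzero on both class vectors must use one column from
    each of the two classes. This leaves few pairs to exclude below. *)
Lemma binary_pin_neq0 c d i j t u : c != d -> u != 0 ->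
    (forall m, m \in [:: c; d] -> class_vec m 0 j - t * class_vec m 0 i = u) ->
  (r i = c /\ r j = d \/ r i = d /\ r j = c) /\ t = 1.
Proof.
move=> cd u0 pin.
have u1 := card2_neq0 q2 u0.
have := pin d; have := pin c; rewrite !inE !eqxx orbT !mxE u1.
move=> /(_ isT) hc /(_ isT) hd; move: hc hd.
have t01 : t = 0 \/ t = 1.
  by have [|t0] := eqVneq t 0; [left | right; apply: card2_neq0].
have [jc|jc] := eqVneq (r j) c.
  rewrite jc (negPf cd) /= => _; case: (eqVneq (r i) d) => [id|_] /=; last first.
    by rewrite mulr0 subr0 => /esym/eqP; rewrite oner_eq0.
  rewrite mulr1 sub0r => e; split; first by right.
  by case: t01 e => // ->; rewrite oppr0 => /esym/eqP; rewrite oner_eq0.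
case: (eqVneq (r i) c) => [ic|_] /=; last first.
  by rewrite mulr0 subr0 => /esym/eqP; rewrite oner_eq0.
rewrite mulr1 sub0r => e.
have -> : t = 1.
  by case: t01 e => // ->; rewrite oppr0 => /esym/eqP; rewrite oner_eq0.
rewrite ic (negPf cd) /= mulr0 subr0; case: (eqVneq (r j) d) => [jd _|_] /=.
  by split=> //; left.
by move=> /esym/eqP; rewrite oner_eq0.
Qed.

(** The class vectors leave only the pair [c], [d], as both classes are singletons; but [nonrep_vec]
    vanishes at [c] and [d] and has [f = 1]. *)
Lemma not_star_two_singletons c d : #|reps| = k -> c \in reps -> d \in reps -> c != d ->
  (forall i, r i = c -> i = c) -> (forall i, r i = d -> i = d) -> ~ is_star k S.
Proof.
move=> Rk cR dR cd c1 d1; have [Z [dZ hZ CZ]] := binary_span.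
have [s sS scd] := reps_neq cR dR cd.
have rep_id m : m \in reps -> r m = m by rewrite inE => /andP[/eqP].
have rj m : m \in reps -> m != j0 by rewrite inE => /andP[].
pose f (v : 'rV[F]_n) := v 0 c + v 0 d + v 0 j0.
have hf : linear_functional f by move=> t v w; rewrite /f !mxE; ring.
apply: (not_star (W := Z) (f := f) (x := s)) => //.
- exact: ltnW.
- by rewrite /f S0 // addr0.
- by rewrite dZ Rk.
move=> i j t u ij u0 pin.
have [m mcd|cases t1] := binary_pin_neq0 (i := i) (j := j) (t := t) cd u0.
  have mR : m \in reps by move: mcd; rewrite in_cons mem_seq1 => /orP[] /eqP ->.
  rewrite pin ?hZ ?class_vec_in //; move: mcd; rewrite !inE => /orP[] /eqP ->;
    rewrite /f !mxE (rep_id _ cR) (rep_id _ dR) rr_j0 eqxx.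
    by rewrite (eq_sym d) (eq_sym j0) (negPf cd) (negPf (rj _ cR)) /= !addr0 mulr1.
  by rewrite (negPf cd) (eq_sym j0) (negPf (rj _ dR)) /= add0r addr0 mulr1.
have := pin nonrep_vec; rewrite hZ nonrep_vec_in => /(_ isT).
rewrite /f !mxE rr_j0 (rep_id _ cR) (rep_id _ dR) !eqxx (negPf (rj _ cR)) (negPf (rj _ dR)).
rewrite /= !add0r mulr1 t1 mul1r => e.
have [iP jP] : i \in [:: c; d] /\ j \in [:: c; d].
  by case: cases => -[]; [move=> /c1 -> /d1 -> | move=> /d1 -> /c1 ->];
    rewrite !inE !eqxx ?orbT.
have nr l : l \in [:: c; d] -> (r l != l) || (l == j0) = false.
  rewrite in_cons mem_seq1 => lP; have lR : l \in reps by case/orP: lP => /eqP ->.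
  by rewrite rep_id // eqxx (negPf (rj _ lR)).
by move: e; rewrite !nr // subr0 => e; rewrite -e eqxx in u0.
Qed.

(** The space of [binary_span] has dimension only [k], so a vector [w] is adjoined. On that space
    [f] agrees with the sum of the coordinates at [r x] and [r y], and [w] breaks this. Of the pairs
    with one column in each class, [nonrep_vec] excludes those mixing a representative with a
    nonrepresentative, and [w] excludes the others. *)
Lemma not_star_few_reps x y : #|reps| = (k - 1)%N -> x \in nonreps -> y \in nonreps ->
  x != y -> ~ is_star k S.
Proof.
move=> Rk xN yN xy; have [Z [dZ hZ CZ]] := binary_span.
have {}dZ : \dim Z = k by rewrite dZ Rk subn1 prednK // ltnW.
have {xN} xN : r x != x by rewrite inE in xN.
have {yN} yN : r y != y by rewrite inE in yN.
have xj : x != j0 by apply: contraNneq xN => ->; rewrite rr_j0.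
have yj : y != j0 by apply: contraNneq yN => ->; rewrite rr_j0.
have xR := rep_mem xj; have yR := rep_mem yj.
have rxy : r x != r y.
  apply/eqP => rxy; have [e|e] := class_pair xy rxy (esym (rr x)).
    by rewrite e eqxx in xN.
  by rewrite -rxy e eqxx in yN.
have [s sS sxy] := reps_neq xR yR rxy.
pose w : 'rV[F]_n := \row_l ((l == r x) || (l == y))%:R.
have yrx : (y == r x) = false by apply/eqP => e; case/eqP: rxy; rewrite e rr.
have xry : (x == r y) = false by apply/eqP => e; case/eqP: rxy; rewrite e rr.
have ryj : (r y == j0) = false by rewrite rj0 (negPf yj).
have rxj : (r x == j0) = false by rewrite rj0 (negPf xj).
have wZ : w \notin Z.
  rewrite hZ; apply/forallPn; exists x; rewrite !mxE eqxx (eq_sym x (r x)) (negPf xN) (negPf xy).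
  by rewrite (eq_sym j0) rxj (eq_sym j0) (negPf yj) /= mulr0 addr0 eq_sym oner_eq0.
have dW : \dim (Z + <[w]>) = k.+1 by rewrite dim_addv_line // dZ.
have ZW : (Z <= Z + <[w]>)%VS := addvSl _ _.
pose f (v : 'rV[F]_n) := v 0 (r y) + v 0 x + v 0 j0.
have hf : linear_functional f by move=> t v z; rewrite /f !mxE; ring.
apply: (not_star (W := (Z + <[w]>)%VS) (f := f) (x := s)) => //.
- exact: ltnW.
- by rewrite /f S0 // addr0 (rS x) // lam_binary mul1r addrC.
- by move=> C /CZ CZ'; apply: subv_trans CZ' ZW.
move=> i j t u ij u0 pin.
have pinZ v : v \in Z -> v 0 j - t * v 0 i = u * f v by move=> /(subvP ZW) /pin.
have [m mxy|cases t1] := binary_pin_neq0 (i := i) (j := j) (t := t) rxy u0.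
  have mR : m \in reps by move: mxy; rewrite in_cons mem_seq1 => /orP[] /eqP ->.
  rewrite pinZ ?hZ ?class_vec_in //; move: mxy; rewrite !inE => /orP[] /eqP ->;
    rewrite /f !mxE !rr rr_j0 (eq_sym j0) eqxx.
    by rewrite (eq_sym (r y)) (negPf rxy) rxj /= add0r addr0 mulr1.
  by rewrite (negPf rxy) ryj /= !addr0 mulr1.
have := pinZ nonrep_vec; rewrite hZ nonrep_vec_in => /(_ isT).
have := pin w; rewrite (subvP (addvSr Z _)) ?memv_line // => /(_ isT).
rewrite /f !mxE t1 !mul1r !eqxx rr_j0 !rr ryj xN !eqxx orbT.
rewrite (eq_sym (r y) (r x)) (negPf rxy) (negPf yN) (eq_sym x (r x)) (negPf xN) (negPf xy).
rewrite (eq_sym j0) rxj (eq_sym j0) (negPf yj) /= !addr0 mulr0 add0r (card2_addrr _ q2) mulr0.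
have bit (a b : bool) : (a%:R - b%:R : F) = 0 -> a = b.
  move=> /eqP; rewrite subr_eq0; case: a; case: b => //=; first by rewrite oner_eq0.
  by rewrite eq_sym oner_eq0.
move=> /bit ew /bit en.
have cls l : r l = r x -> l = x \/ l = r x.
  by move=> rl; apply: (class_pair (i := x) (j := r x)); rewrite ?rr // eq_sym.
have cls' l : r l = r y -> l = y \/ l = r y.
  by move=> rl; apply: (class_pair (i := y) (j := r y)); rewrite ?rr // eq_sym.
move: ew en; have [[/cls ci /cls' cj]|[/cls' ci /cls cj]] := cases;
  case: ci => ->; case: cj => ->;
  rewrite ?eqxx ?rr ?(negPf xy) ?(eq_sym y x) ?(negPf xy) ?(eq_sym x (r x)) ?(negPf xN) ?xN ?yN ?eqxx
    ?yrx ?xry ?rxj ?ryj ?(eq_sym (r y) (r x)) ?(negPf rxy) ?(negPf yN) ?(eq_sym (r x) y) ?yrx ?orbT //=.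
Qed.

(** A projective [D] of dimension 3 in [Z] satisfies a relation among the coordinates in [reps] and
    at [j0], in which all three representatives must occur; they also all occur in a relation on
    [S]. So [S] and the part [D0] of [D] that vanishes at [j0] satisfy the same relation, and having
    dimension 2 they coincide. *)
Lemma star_three_reps x y : k = 3%N -> #|reps| = 3%N -> x \in nonreps -> y \in nonreps ->
  x != y -> is_star k S.
Proof.
move=> k3 R3 xN yN xy; have [Z [dZ hZ CZ]] := binary_span.
have {xN} xN : r x != x by rewrite inE in xN.
have {yN} yN : r y != y by rewrite inE in yN.
have xj : x != j0 by apply: contraNneq xN => ->; rewrite rr_j0.
have yj : y != j0 by apply: contraNneq yN => ->; rewrite rr_j0.
have xR := rep_mem xj; have yR := rep_mem yj.
have rxy : r x != r y.
  apply/eqP => rxy; have [e|e] := class_pair xy rxy (esym (rr x)).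
    by rewrite e eqxx in xN.
  by rewrite -rxy e eqxx in yN.
have [z zR zn] : exists2 z, z \in reps & z \notin [set r x; r y].
  apply/subsetPn; apply/negP => /subset_leq_card.
  by rewrite R3 cards2; case: (r x != r y).
have defR : reps = r x |: (r y |: [set z]).
  move: zn; rewrite !inE negb_or => /andP[zx zy].
  apply/esym/eqP; rewrite eqEcard R3 !subUset !sub1set xR yR zR /=.
  by rewrite !cardsU1 cards1 !inE negb_or rxy (eq_sym (r x)) zx (eq_sym (r y)) zy.
move: zn; rewrite !inE negb_or => /andP[zx zy].
have xz : r x != z by rewrite eq_sym.
have yz : r y != z by rewrite eq_sym.
have sumR (g : 'I_n -> F) : \sum_(l in reps) g l = g (r x) + (g (r y) + g z).
  rewrite defR big_setU1 ?inE ?negb_or ?rxy ?(eq_sym (r x)) //.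
  by rewrite big_setU1 ?inE ?(eq_sym (r y)) // big_set1.
have j0R : j0 \notin reps by rewrite inE eqxx andbF.
have neqj c : c \in reps -> c != j0 by rewrite inE => /andP[].
have rep_id m : m \in reps -> r m = m by rewrite inE => /andP[/eqP].
have bit (a : F) : a = 0 \/ a = 1.
  by have [|a0] := eqVneq a 0; [left | right; apply: card2_neq0].
have oppF (a : F) : - a = a by apply/eqP; rewrite eq_sym -addr_eq0 card2_addrr.
have eqF (a b : F) : a + b = 0 -> a = b by move=> /eqP; rewrite addr_eq0 oppF => /eqP.
have SZ : (S <= Z)%VS.
  have [g /extension_code gC] := exists_separating hq.
  by apply: subv_trans (CZ _ gC); apply: addvSl.
apply: (star_of_subspace (H := Z) (J := reps)) => //.
- by move=> i _; rewrite q2 ltnS; apply/card_le1_eqP => a b; rewrite !inE;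
    move=> /andP[/andP[/eqP ra _] /eqP rai] /andP[/andP[/eqP rb _] /eqP rbi];
    rewrite -ra -rb rai rbi.
- by rewrite R3 k3.
move=> D dD uD DZ.
(* Every nonzero relation between [r p], [l] and [j0] pins [D]; if all three occur, coordinates [p]
   and [l] agree, since [v p = v (r p) + v j0] on [Z]. *)
have hrel p l a b d : r p != p -> p != j0 -> l \in reps -> r p != l ->
    (forall v, v \in D -> a * v 0 (r p) + (b * v 0 l + d * v 0 j0) = 0) ->
    [/\ a = 0, b = 0 & d = 0].
  move=> pp pj lR pl h; have cj : r p != j0 by rewrite rj0.
  have lj := neqj l lR.
  case: (bit a) (bit b) (bit d) h => -> [] -> [] -> h; [by split | exfalso ..].
  - apply: (uD l j0 0 lj) => v /h.
    by rewrite !mul0r !add0r mul1r.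
  - apply: (uD j0 l 0); [by rewrite eq_sym | move=> v /h].
    by rewrite !mul0r addr0 add0r mul1r.
  - apply: (uD j0 l 1); [by rewrite eq_sym | move=> v /h].
    by rewrite mul0r add0r !mul1r => /eqF.
  - apply: (uD j0 (r p) 0); [by rewrite eq_sym | move=> v /h].
    by rewrite !mul0r !addr0 mul1r.
  - apply: (uD j0 (r p) 1); [by rewrite eq_sym | move=> v /h].
    by rewrite mul0r add0r !mul1r => /eqF.
  - apply: (uD l (r p) 1); [by rewrite eq_sym | move=> v /h].
    by rewrite mul0r addr0 !mul1r => /eqF.
  apply: (uD l p 1) => [|v vD].
    by apply: contraNneq pl => <-; rewrite (rep_id _ lR).
  have := subvP DZ _ vD; rewrite hZ => /forallP/(_ p)/eqP ->.
  by rewrite pp !mul1r; have := h v vD; rewrite !mul1r addrCA => /eqF ->.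
have [|a [m mJ am] ha] := @exists_relation _ _ D (j0 |: reps).
  by rewrite cardsU1 j0R R3 dD k3.
have {}ha v : v \in D -> a (r x) * v 0 (r x) + (a (r y) * v 0 (r y) + a z * v 0 z) +
    a j0 * v 0 j0 = 0.
  by move=> /ha; rewrite big_setU1 //= sumR addrC.
(* Any two representatives include [r x] or [r y], whose class has a second column, so [hrel]
   applies as soon as one coefficient is 0. *)
have nz : [/\ a (r x) = 1, a (r y) = 1 & a z = 1].
  have fin : a (r x) = 0 -> a (r y) = 0 -> a z = 0 -> a j0 = 0 -> False.
    move=> h1 h2 h3 h4; move: mJ am; rewrite defR !inE.
    by case/or4P => /eqP ->; rewrite ?h1 ?h2 ?h3 ?h4 eqxx.
  split; apply: (card2_neq0 q2); apply/eqP => e0.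
  - have [v /ha|h1 h2 h3] := @hrel y z (a (r y)) (a z) (a j0) yN yj zR yz.
      by rewrite e0 mul0r add0r addrA.
    exact: fin.
  - have [v /ha|h1 h2 h3] := @hrel x z (a (r x)) (a z) (a j0) xN xj zR xz.
      by rewrite e0 mul0r add0r addrA.
    exact: fin.
  - have [v /ha|h1 h2 h3] := @hrel x (r y) (a (r x)) (a (r y)) (a j0) xN xj yR rxy.
      by rewrite e0 mul0r addr0 addrA.
    exact: fin.
have [a1 a2 a3] := nz.
have [|b [m' mJ' bm] hb] := @exists_relation _ _ S reps; first by rewrite R3 dS k3.
have {}hb v : v \in S -> b (r x) * v 0 (r x) + (b (r y) * v 0 (r y) + b z * v 0 z) = 0.
  by move=> /hb; rewrite sumR.
have relS c d e f : c \in reps -> d \in reps -> c != d ->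
    (forall v, v \in S -> e * v 0 c + f * v 0 d = 0) -> e = 0 /\ f = 0.
  move=> cR dR cd h; have [cj dj] := (neqj c cR, neqj d dR).
  case: (bit e) (bit f) h => -> [] -> h; [by split | exfalso ..].
  - have [s sS] := Sn0 dj; have := h s sS; rewrite mul0r add0r mul1r => ->; by rewrite eqxx.
  - have [s sS] := Sn0 cj; have := h s sS; rewrite mul0r addr0 mul1r => ->; by rewrite eqxx.
  have [s sS] := reps_neq cR dR cd; have := h s sS; rewrite !mul1r => ->; by rewrite eqxx.
have nzb : [/\ b (r x) = 1, b (r y) = 1 & b z = 1].
  have fin : b (r x) = 0 -> b (r y) = 0 -> b z = 0 -> False.
    move=> h1 h2 h3; move: mJ' bm; rewrite defR !inE.
    by case/or3P => /eqP ->; rewrite ?h1 ?h2 ?h3 eqxx.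
  split; apply: (card2_neq0 q2); apply/eqP => e0.
  - have [v /hb|h1 h2] := relS (r y) z (b (r y)) (b z) yR zR yz.
      by rewrite e0 mul0r add0r.
    exact: fin.
  - have [v /hb|h1 h2] := relS (r x) z (b (r x)) (b z) xR zR xz.
      by rewrite e0 mul0r add0r.
    exact: fin.
  - have [v /hb|h1 h2] := relS (r x) (r y) (b (r x)) (b (r y)) xR yR rxy.
      by rewrite e0 mul0r addr0.
    exact: fin.
have [b1 b2 b3] := nzb.
have hf : linear_functional (fun v : 'rV[F]_n => v 0 j0) by move=> t v w; rewrite !mxE.
have [w wD wj0] := unpinned_neq0 j0 n1 uD.
have [D0 [D0D dD0 hD0]] := hyperplane hf wD wj0.
have {}dD0 : \dim D0 = 2%N by apply: succn_inj; rewrite dD0 dD k3.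
have dS2 : \dim S = 2%N by rewrite dS k3.
(* On [D0 + S] the entry at [j0] is 0 and the one at [z] is the sum of those at [r x] and [r y], so
   these two determine the vector. *)
have dK : (\dim (D0 + S) <= 2)%N.
  have -> : 2%N = #|[set r x; r y]| by rewrite cards2 rxy.
  apply: dim_le_coords => v /memv_addP[d dD1 [s sS ->]] v0.
  have dsZ : d + s \in Z.
    by apply: memvD; [apply/(subvP DZ)/(subvP D0D) | apply/(subvP SZ)].
  have /andP[dD' /eqP dj0] : (d \in D) && (d 0 j0 == 0) by rewrite -hD0.
  have vx : (d + s) 0 (r x) = 0 by apply: v0; rewrite !inE eqxx.
  have vy : (d + s) 0 (r y) = 0 by apply: v0; rewrite !inE eqxx orbT.
  have vj : (d + s) 0 j0 = 0 by rewrite mxE dj0 S0 // addr0.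
  have vz : (d + s) 0 z = 0.
    have := ha d dD'; rewrite a1 a2 a3 dj0 mulr0 !mul1r addr0 => h1.
    have := hb s sS; rewrite b1 b2 b3 !mul1r => h2.
    have -> : (d + s) 0 z = (d 0 (r x) + (d 0 (r y) + d 0 z)) +
      (s 0 (r x) + (s 0 (r y) + s 0 z)) - (d + s) 0 (r x) - (d + s) 0 (r y).
      by rewrite !mxE; ring.
    by rewrite h1 h2 vx vy !subr0 addr0.
  move: dsZ; rewrite hZ => /forallP hv; apply/rowP => i; rewrite (eqP (hv i)) vj mulr0 addr0 [RHS]mxE.
  have [->|ii] := eqVneq i j0; first by rewrite rr_j0 vj.
  by have := rep_mem ii; rewrite defR !inE => /or3P[] /eqP ->.
have /eqP eD : (D0 == D0 + S)%VS by rewrite eqEdim addvSl dD0 dK.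
by apply: subv_trans D0D; rewrite eD addvSr.
Qed.

End Binary.

End Classes.

(** * Partitions into the fibres of a map *)

Section Partition.
Variables (T T' : finType) (e : rel T) (f : T -> T').
Hypothesis ef : forall x y, e x y = (f x == f y).

Lemma equivalence_partitionE : equivalence_partition e [set: T] =
  [set [set y | f y == z] | z in f @: [set: T]].
Proof.
rewrite /equivalence_partition -imset_comp; apply: eq_imset => x /=.
by apply/setP => y; rewrite !inE ef eq_sym.
Qed.

Lemma card_equivalence_partition :
  #|equivalence_partition e [set: T]| = #|f @: [set: T]|.
Proof.
rewrite equivalence_partitionE card_in_imset // => _ _ /imsetP[x _ ->] /imsetP[y _ ->].
by move/setP/(_ x); rewrite !inE eqxx => /esym/eqP.
Qed.

Lemma equivalence_partitionP A :
  reflect (exists x, A = [set y | f y == f x]) (A \in equivalence_partition e [set: T]).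
Proof.
rewrite equivalence_partitionE; apply: (iffP imsetP) => [[_ /imsetP[x _ ->] ->]|[x ->]].
  by exists x.
by exists (f x); rewrite ?imset_f.
Qed.

End Partition.

(** * Canonical representatives and scalars of the columns *)

Section ColumnClasses.
Variables (F : finFieldType) (m n : nat) (M : 'M[F]_(m, n)).

Lemma col_equiv_refl i : col_equiv M i i.
Proof. by apply/existsP; exists 1; rewrite oner_eq0 scale1r eqxx. Qed.

Lemma col_equiv_sym i j : col_equiv M i j -> col_equiv M j i.
Proof.
case/existsP => c /andP[c0 /eqP e]; apply/existsP; exists c^-1.
by rewrite invr_eq0 c0 e scalerA mulVf // scale1r eqxx.
Qed.

Lemma col_equiv_trans i j l : col_equiv M i j -> col_equiv M j l -> col_equiv M i l.
Proof.
case/existsP => c /andP[c0 /eqP e] /existsP[d /andP[d0 /eqP e']].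
by apply/existsP; exists (d * c); rewrite mulf_neq0 //= e' e scalerA eqxx.
Qed.

(** The choice made by [pick] depends only on the set of columns equivalent to [i], hence is the
    same for a whole class; the default is never taken, since [i] is equivalent to itself. *)
Definition col_rep i := odflt i [pick j | col_equiv M i j].

Lemma col_repP i : col_equiv M i (col_rep i).
Proof. by rewrite /col_rep; case: pickP => //= _; apply: col_equiv_refl. Qed.

Lemma col_equivE i j : col_equiv M i j = (col_rep i == col_rep j).
Proof.
apply/idP/eqP => [ij|e].
  have ext : col_equiv M i =1 col_equiv M j.
    by move=> l; apply/idP/idP; apply: col_equiv_trans; [apply: col_equiv_sym|].
  rewrite /col_rep (eq_pick ext); case: pickP => // /(_ j).
  by rewrite /= col_equiv_refl.
by apply: (col_equiv_trans (col_repP i)); rewrite e; apply/col_equiv_sym/col_repP.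
Qed.

Definition col_scalar i : F :=
  odflt 1 [pick c | (c != 0) && (col i M == c *: col (col_rep i) M)].

Lemma col_scalarP i :
  col_scalar i != 0 /\ col i M = col_scalar i *: col (col_rep i) M.
Proof.
rewrite /col_scalar; case: pickP => [c /andP[c0 /eqP e] //|none].
by case/existsP: (col_equiv_sym (col_repP i)) => c; rewrite none.
Qed.

End ColumnClasses.

(** * Assembly of the cases by [q] and by the number of column classes *)

Theorem theorem3 (F : finFieldType) (q : nat) (hq : #|F| = q) (n k : nat)
    (hk1 : (1 < k)%N) (hkn : (k < n - 1)%N)
    (S : {vspace 'rV[F]_n}) (hS : \dim S = (k - 1)%N)
    (M : 'M[F]_(k - 1, n)) (hM : generator_matrix M S)
    (j0 : 'I_n) (hj0 : [set j | col j M == 0] = [set j0])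
    (hprop : has_proportional_cols (col' j0 M)) :
  is_star k S <->
  (forall j : 'I_n, (class_size M j <= q)%N) /\
  (let lS' := #|col_classes (col' j0 M)| in
   [\/ q = 2%N /\
       ((lS' = k /\ k = 3%N /\ (k < n - 2)%N) \/
        ((k + 1 <= lS')%N /\ (k < n - 2)%N)),
       q = 3%N /\
       [\/ lS' = (k - 1)%N /\ (k - 1 = 1)%N,
           lS' = (k - 1)%N /\ (2 <= #|repeated_classes M|)%N
         | (k <= lS')%N]
     | (4 <= q)%N]).
Proof.
subst q.
have n1 : (1 < n)%N by lia.
pose r := col_rep M; pose lam := col_scalar M.
have colE i : (col i M == 0) = (i == j0).
  by have /setP/(_ i) := hj0; rewrite !inE.
have pinM i j c : pinned S i j c <-> col j M = c *: col i M := pinnedP i j c hM.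
have lam0 i : lam i != 0 := (col_scalarP M i).1.
have rS s i : s \in S -> s 0 i = lam i * s 0 (r i).
  by move: s; apply/pinM; apply: (col_scalarP M i).2.
have S0 s : s \in S -> s 0 j0 = 0.
  (* A zero column is expressed as a coordinate pinned to itself with factor 0. *)
  move=> sS; rewrite -[RHS](mul0r (s 0 j0)); move: s sS; apply/pinM.
  by rewrite scale0r; apply/eqP; rewrite colE.
have Sn0 i : i != j0 -> exists2 s, s \in S & s 0 i != 0.
  move=> ii; have : ~~ [forall s, (s \in S) ==> (s 0 i == 0)].
    apply: contra ii => /forallP h; rewrite -colE.
    suff /pinM -> : pinned S i i 0 by rewrite scale0r.
    by move=> s sS; have := h s; rewrite sS mul0r => /eqP.
  by case/forallPn => s; rewrite negb_imply => /andP[]; exists s.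
have rpin i j c : i != j0 -> j != j0 -> pinned S i j c -> r i = r j.
  move=> ii jj /pinM e; apply/eqP; rewrite -col_equivE; apply/existsP; exists c.
  by rewrite e eqxx andbT; apply: contraNneq jj => c0; rewrite -colE e c0 scale0r.
have rr i : r (r i) = r i.
  by apply/esym/eqP; rewrite -col_equivE; apply: col_repP.
have rj0 i : (r i == j0) = (i == j0).
  have [l0 e] := col_scalarP M i; rewrite -!colE e scaler_eq0 -/(lam i) (negPf (lam0 i)).
  by [].
have sizeE j : class_size M j = #|class_of r j|.
  by apply: eq_card => i; rewrite !inE col_equivE eq_sym.
(* Each class other than that of [j0] has one representative, so [l(S')] is the size of [reps]. *)
have cE : #|col_classes (col' j0 M)| = #|reps j0 r|.
  have ef a b : col_equiv (col' j0 M) a b = (r (lift j0 a) == r (lift j0 b)).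
    rewrite -col_equivE; apply: eq_existsb => c; congr (_ && _).
    apply/eqP/eqP => /colP h; apply/colP => l; have := h l; rewrite !mxE //.
  rewrite /col_classes (card_equivalence_partition ef); apply: eq_card => c.
  apply/imsetP/idP => [[a _ ->]|cR].
    by apply: rep_mem => //; rewrite eq_sym neq_lift.
  have /andP[/eqP rc cj] : (r c == c) && (c != j0) by rewrite inE in cR.
  case: (unliftP j0 c) cj rc => [a ->|-> /eqP //] _ rc.
  by exists a; rewrite ?inE ?rc.
rewrite /= cE.
have cRN := card_reps_nonreps rj0.
have dR := dim_le_reps hS rS S0 rr rj0.
(* Of two proportional columns, at least one is not a representative. *)
have [x xN] : exists x, x \in nonreps r.
  case: hprop => a [b [ab]] /existsP[c /andP[c0 /eqP e]].
  have rab : r (lift j0 a) = r (lift j0 b).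
    apply/eqP; rewrite -col_equivE; apply/existsP; exists c; rewrite c0 /=.
    by apply/eqP/colP => l; have /colP/(_ l) := e; rewrite !mxE.
  have [ra|ra] := eqVneq (r (lift j0 a)) (lift j0 a); last by exists (lift j0 a); rewrite inE.
  exists (lift j0 b); rewrite inE -rab ra (inj_eq lift_inj) //.
have N0 : (0 < #|nonreps r|)%N by apply/card_gt0P; exists x.
have q_gt1 : (1 < #|F|)%N := finNzRing_gt1 F.
have two_repeated y z : r y != y -> r z != z -> r y != r z ->
    (2 <= #|repeated_classes M|)%N.
  move=> yN zN yz; apply/card_gt1P; exists (class_of r y), (class_of r z).
  have rep a : r a != a -> class_of r a \in repeated_classes M.
    move=> aN; rewrite inE; apply/andP; split.
      by apply/(equivalence_partitionP (col_equivE M)); exists a.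
    by apply/card_gt1P; exists a, (r a); rewrite !inE rr eq_sym.
  split; rewrite ?rep //; apply: contra yz => /eqP/setP/(_ y).
  by rewrite !inE eqxx => /esym.
have repeated_two : (2 <= #|repeated_classes M|)%N -> exists y z,
    [/\ y \in nonreps r, z \in nonreps r & r y != r z].
  have nonrep a : (1 < #|[set b | r b == r a]|)%N -> exists2 y, y \in nonreps r & r y = r a.
    case/card_gt1P => b [c []]; rewrite !inE => /eqP rb /eqP rc bc.
    have [e|bN] := eqVneq (r b) b; last by exists b; rewrite ?inE.
    by exists c; rewrite ?inE // rc -rb e.
  case/card_gt1P => A [B []]; rewrite !inE.
  case/andP => /(equivalence_partitionP (col_equivE M))[a ->] /nonrep[y yN ya].
  case/andP => /(equivalence_partitionP (col_equivE M))[b ->] /nonrep[z zN zb] AB.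
  exists y, z; split=> //; apply: contraNneq AB => yz.
  by apply/eqP/setP => l; rewrite !inE -/(r l) -/(r a) -/(r b) -ya -zb yz.
split.
  (* A maximal clique is nonempty here, so a code above [S] exists and bounds the class sizes by
     [q]. *)
  move=> star; have [[[C CS] _ _] _] := star.
  have cs i : (#|class_of r i| <= #|F|)%N.
    by apply: (code_class_size n1 hk1 hS lam0 rS S0 rj0 i CS).
  split; first by move=> j; rewrite sizeE.
  have pick (A : {set 'I_n}) : (#|A| < #|reps j0 r|)%N ->
      exists2 a, a \in reps j0 r & a \notin A.
    by move=> lt; apply/subsetPn; apply: contraL lt => /subset_leq_card; rewrite -leqNgt.
  have [q2|[q3|q4]] : #|F| = 2%N \/ #|F| = 3%N \/ (4 <= #|F|)%N.
  - by move: q_gt1; clear; lia.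
  - constructor 1; split=> //; case: (ltngtP #|reps j0 r| k) => Rk.
    (* With [k - 1] representatives there are [n - k >= 2] nonrepresentatives. *)
    + have {}Rk : #|reps j0 r| = (k - 1)%N by move: Rk dR; clear; lia.
      have [|b [c [bN cN bc]]] := @card_gt1P _ (nonreps r) _; first by move: Rk cRN hkn hk1; clear; lia.
      by case: (not_star_few_reps n1 hk1 hS lam0 rS S0 rpin rr rj0 q2 cs Rk bN cN bc).
    + by right; split; [rewrite addn1 | move: Rk cRN N0; clear; lia].
    have [k4|k4] := leqP 4 k.
      by case: (not_star_four_reps n1 hk1 hS lam0 rS S0 rpin rr rj0 q2 Rk k4).
    have k_neq2 : k <> 2%N.
      move=> k2; suff : (#|reps j0 r| <= 1)%N by rewrite Rk k2.
      apply/card_le1_eqP => a b; rewrite !inE => /andP[/eqP ra aj] /andP[/eqP rb bj].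
      by rewrite -ra -rb; apply: (one_rep hS Sn0 rpin k2).
    have k3 : k = 3%N by move: k_neq2 hk1 k4; clear; lia.
    (* If [n <= 5], at most one column is not a representative, so at least two of the three classes
       are singletons. *)
    left; do 2!split=> //; rewrite ltnNge; apply/negP => nk.
    have N1 : (#|nonreps r| <= 1)%N by move: nk cRN; rewrite Rk k3; clear; lia.
    have single a i : a != r x -> r i = a -> i = a.
      move=> ax ri; apply/eqP; apply: contraNT ax => ia.
      suff <- : i = x by rewrite ri.
      by apply: (card_le1_eqP N1); rewrite // inE ri eq_sym.
    have [|c cR cx] := pick [set r x]; first by rewrite cards1 Rk k3.
    have [|d d_rep dx] := pick [set r x; c]; first by rewrite cards2 Rk k3; case: (r x != c).
    move: cx dx; rewrite !inE negb_or => cx /andP[dx]; rewrite eq_sym => cd.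
    by case: (not_star_two_singletons n1 hk1 hS lam0 rS S0 rpin rr rj0 q2 Rk cR d_rep cd
      (fun i => single c i cx) (fun i => single d i dx)).
  - constructor 2; split=> //; have [Rk|Rk] := leqP k #|reps j0 r|; first by constructor 3.
    have {}Rk : #|reps j0 r| = (k - 1)%N by move: Rk dR; clear; lia.
    have [k2|k2] := eqVneq k 2%N; first by constructor 1; rewrite Rk k2.
    have k3 : (2 < k)%N by move: k2 hk1; clear; lia.
    constructor 2; split=> //.
    have [|b [c [bN cN bc]]] := @card_gt1P _ (nonreps r) _; first by move: Rk cRN hkn hk1; clear; lia.
    have [/exists_inP[y yN /exists_inP[z zN yz]]|same] :=
        boolP [exists y in nonreps r, [exists z in nonreps r, r y != r z]].
      by apply: (two_repeated y z) => //; move: yN zN; rewrite !inE.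
    have {}same y : y \in nonreps r -> r y = r b.
      move=> yN; apply/eqP; apply: contraNT same => yb.
      by apply/exists_inP; exists y => //; apply/exists_inP; exists b.
    (* All nonrepresentatives lie in one class of at most three columns, so there are exactly two of
       them and [n - 1 = (k - 1) + 2]. *)
    have {}nk : n = k.+2.
      have : (#|nonreps r| <= #|class_of r b :\ r b|)%N.
        apply/subset_leq_card/subsetP => l lN; rewrite !inE same // eqxx andbT.
        by apply: contraTneq lN => ->; rewrite inE rr eqxx.
      have : (#|class_of r b :\ r b| < 3)%N.
        by have := cs b; rewrite q3 (cardsD1 (r b) (class_of r b)) inE rr eqxx.
      by move: Rk cRN hkn hk1; move: #|_ :\ _|; clear; lia.
    have [|e eR eb] := pick [set r b].
      by rewrite cards1 Rk; move: k3; clear; lia.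
    have bj : b != j0.
      by apply: contraTneq bN => ->; rewrite inE (eqP (_ : r j0 == j0)) ?rj0 ?eqxx.
    exfalso; apply: (not_star_single_triple (lam := lam) (a := r b) (b := b) (c := c)
      n1 hk1 hS lam0 rS S0 Sn0 rj0 q3 _ _ _ _ _ _ nk eR _ star); rewrite ?rr //.
    + by rewrite rj0.
    + by rewrite inE in bN.
    + by rewrite -(same c) //; rewrite inE in cN.
    + by rewrite same.
    + by rewrite inE in eb.
  by constructor 3.
case=> cs; have {}cs i : (#|class_of r i| <= #|F|)%N by rewrite -sizeE.
case=> [[q2]|[q3]|q4]; last exact: (star_ge4 n1 hk1 hS lam0 rS S0 Sn0 rpin rr rj0 cs q4 hkn).
  case=> [[Rk [k3 kn]]|[Rk _]].
    have [|b [c [bN cN bc]]] := @card_gt1P _ (nonreps r) _; first by move: kn cRN; rewrite Rk; clear; lia.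
    rewrite k3 in Rk.
    exact: (star_three_reps n1 hk1 hS lam0 rS S0 Sn0 rpin rr rj0 q2 cs k3 Rk bN cN bc).
  apply: (star_card2 n1 hk1 hS lam0 rS S0 Sn0 rpin rj0 cs q2).
  by rewrite -addn1.
have q3' : (3 <= #|F|)%N by rewrite q3.
case=> [[Rk k2]|[_ /repeated_two[y [z [yN zN yz]]]]|kR].
- have {}k2 : k = 2%N by move: k2; clear; lia.
  (* The only class besides that of [j0] has [n - 2 >= 2] nonrepresentatives, hence the full size
     3. *)
  have [|b [c [bN cN bc]]] := @card_gt1P _ (nonreps r) _; first by move: Rk cRN hkn; rewrite k2; clear; lia.
  have nj l : l \in nonreps r -> l != j0.
    by apply: contraTneq => ->; rewrite inE (eqP (_ : r j0 == j0)) ?rj0 ?eqxx.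
  have one i j : i != j0 -> j != j0 -> r i = r j := one_rep hS Sn0 rpin k2.
  have rcb : r c = r b by apply: one; apply: nj.
  apply: (star_single_triple (lam := lam) (a := r b) (b := b) (c := c)
    n1 hk1 hS lam0 rS S0 Sn0 rpin rj0); rewrite ?rr //.
  + by rewrite rj0 nj.
  + by rewrite inE in bN.
  + by rewrite -rcb; rewrite inE in cN.
  + by move=> i ij; apply: one => //; apply: nj.
- exact: (star_two_classes n1 hk1 hS lam0 rS S0 Sn0 rpin rr rj0 cs q3' yN zN yz).
- exact: (star_nonrep n1 hk1 hS lam0 rS S0 Sn0 rpin rj0 cs q3' xN kR).
Qed.
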